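(* Let $\mathcal A$ be a Hopf algebra over $\mathbf C$ and let $\mathcal B\subseteq\mathcal A$ be a left coideal subalgebra. (i) Let $\mathcal R$ be a right ideal of $\mathcal B^+$ and let $p:\mathcal B^+\to\mathcal B^+/\mathcal R$ be the canonical projection. Then the formula $a\,\mathrm d b:=a\,b_{(1)}\otimes p(b_{(2)}^+)\in\mathcal A\otimes(\mathcal B^+/\mathcal R)$, for $a,b\in\mathcal B$, uniquely determines an equivariant derivation $\mathrm d_{\mathcal R}:=\mathrm d$ of $\mathcal B$. Moreover, $\mathcal R':=\overline\Delta^{\,-1}(\overline{\mathcal A}\otimes\mathcal R)$ is a right ideal of $\mathcal B^+$, $\mathcal R'\subseteq\mathcal R$, and it satisfies $\overline\Delta(\mathcal R')\subseteq\overline{\mathcal A}\otimes\mathcal R'$ and $\mathrm d_{\mathcal R}=\mathrm d_{\mathcal R'}$. (ii) Let $\mathrm d$ be a derivation of $\mathcal B$. Then $$\mathcal R_{\mathrm d}:=\Bigl\{\sum_i\varepsilon(a_i)\,b_i^+\;\Big|\;a_i,b_i\in\mathcal B,\ \sum_i a_i\,\mathrm d b_i=0\Bigr\}$$ (finite sums) is a right ideal of $\mathcal B^+$. If $\mathrm d$ is equivariant, then $\overline\Delta(\mathcal R_{\mathrm d})\subseteq\overline{\mathcal A}\otimes\mathcal R_{\mathrm d}$. (iii) The maps $\mathcal R\mapsto\mathrm d_{\mathcal R}$ and $\mathrm d\mapsto\mathcal R_{\mathrm d}$ establish a one-to-one correspondence (i.e. restrict to mutually inverse bijections) between the sets $$\{\mathcal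 R_{\mathrm d}\mid \mathrm d\text{ an equivariant derivation of }\mathcal B\}\quad\text{and}\quad\{\mathrm d_{\mathcal R}\mid\mathcal R\text{ a right ideal of }\mathcal B^+\},$$ where $\le$ for the derivations corresponds to $\supseteq$ for the right ideals. Furthermore, $\mathcal R_{\mathrm d_{\mathcal R}}\subseteq\mathcal R$ for every right ideal $\mathcal R$ of $\mathcal B^+$, and $\mathrm d_{\mathcal R_{\mathrm d}}\le\mathrm d$ for every equivariant derivation $\mathrm d$ of $\mathcal B$.
   Context: Algebras are unital associative over $\mathbf C$; $\otimes=\otimes_{\mathbf C}$. $\mathcal A$ has comultiplication $\Delta$, counit $\varepsilon$, antipode $S$; Sweedler notation $\Delta(a)=a_{(1)}\otimes a_{(2)}$ is used. Left coideal subalgebra: a subalgebra $\mathcal B\subseteq\mathcal A$ with $\Delta(\mathcal B)\subseteq\mathcal A\otimes\mathcal B$. For $a\in\mathcal A$ put $a^+:=a-\varepsilon(a)1$, and $\mathcal B^+:=\{b^+\mid b\in\mathcal B\}=\mathcal B\cap\ker\varepsilon$. A right ideal of $\mathcal B^+$ is a linear subspace $\mathcal R\subseteq\mathcal B^+$ with $\mathcal R\,\mathcal B^+\subseteq\mathcal R$ (equivalently, a right ideal of $\mathcal B$ contained in $\mathcal B^+$). A derivation of $\mathcal B$ is a $\mathbf C$-linear map $\mathrm d$ from $\mathcal B$ to a $\mathcal B$-bimodule with $\mathrm d(ab)=a\,\mathrm d b+\mathrm d a\,b$ for all $a,b\in\mathcal B$, where $\mathrm d a\,b$ means $(\mathrm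 d a)b$. Put $\Gamma(\mathrm d):=\mathrm{Lin}_{\mathbf C}\{a\,\mathrm d b\mid a,b\in\mathcal B\}$ (linear span); it is a $\mathcal B$-bimodule. For derivations $\mathrm d,\mathrm d'$ of $\mathcal B$ write $\mathrm d'\le\mathrm d$ if the linear map $\Gamma(\mathrm d)\to\Gamma(\mathrm d')$, $a\,\mathrm d b\mapsto a\,\mathrm d' b$, is well-defined. Derivations $\mathrm d,\mathrm d'$ are considered identical (written $\mathrm d=\mathrm d'$) if $\mathrm d'\le\mathrm d$ and $\mathrm d\le\mathrm d'$. A derivation $\mathrm d$ of $\mathcal B$ is equivariant if the linear map $\Gamma(\mathrm d)\to\mathcal A\otimes\Gamma(\mathrm d)$, $a\,\mathrm d b\mapsto a_{(1)}b_{(1)}\otimes a_{(2)}\,\mathrm d b_{(2)}$ ($a,b\in\mathcal B$), is well-defined. For $\mathrm d_{\mathcal R}$, the space $\Gamma(\mathrm d_{\mathcal R})$ is the linear span of the elements $a\,b_{(1)}\otimes p(b_{(2)}^+)$ in $\mathcal A\otimes(\mathcal B^+/\mathcal R)$, and the bimodule structure is the one forced by the notation and the Leibniz rule: $c\,(a\,\mathrm d b)=(ca)\,\mathrm d b$ and $(a\,\mathrm d b)\,c=a\,\mathrm d(bc)-ab\,\mathrm d c$. $\overline{\mathcal A}:=\mathcal A/(\mathcal B^+\mathcal A)$, where $\mathcal B^+\mathcal A$ is the linear span of products; $\overline{\phantom{a}}:\mathcal A\to\overline{\mathcal A}$ is the canonical projection; $\overline\Delta:=(\overline{\phantom{a}}\otimes\mathrm{id})\circ\Delta:\mathcal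 A\to\overline{\mathcal A}\otimes\mathcal A$. *)

(* Defs.v *)
From HB Require Import structures.
From mathcomp Require Import all_boot all_algebra.
From mathcomp Require Import boolp classical_sets reals.
From mathcomp Require Export complex.
From mathcomp Require Import freeg.

Set Implicit Arguments.
Unset Strict Implicit.
Unset Printing Implicit Defensive.


Import GRing.Theory.

Local Open Scope classical_set_scope.
Local Open Scope ring_scope.
Local Open Scope quotient_scope.

Reserved Notation "x ⊗ y" (at level 40, left associativity).
Reserved Notation "\tsum_ ( x , y <- t ) F"
  (at level 41, x name, y name, t at level 50, F at level 41,
   format "'[' \tsum_ ( x ,  y  <-  t ) '/  '  F ']'").

Section Subspaces.
Variables (K : fieldType) (V : lmodType K).

Definition subspace (N : set V) : Prop :=
  N 0 /\ forall k x y, N x -> N y -> N (k *: x + y).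

Definition span (N : set V) : set V :=
  [set x | exists2 s : seq (K * V), (forall u, u \in s -> N u.2) &
                                    x = \sum_(u <- s) u.1 *: u.2].

Definition in_span (N : set V) : {pred V} := fun x => `[< span N x >].

Lemma in_span_closed N : submod_closed (in_span N).
Proof.
split=> [|k x y /asboolP[s sN ->] /asboolP[t tN ->]]; apply/asboolP.
  by exists [::]; rewrite ?big_nil.
exists ([seq (k * u.1, u.2) | u <- s] ++ t) => [u|].
  by rewrite mem_cat => /orP[/mapP[v /sN Nv ->]//|/tN].
rewrite big_cat big_map scaler_sumr; congr (_ + _).
by apply: eq_bigr => u _; rewrite scalerA.
Qed.

HB.instance Definition _ N :=
  GRing.isSubmodClosed.Build K V (in_span N) (in_span_closed N).

(* The subspace spanned by N as a vector space in its own right, and the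
   quotient of V by that subspace. When N is a subspace these are N and V / N. *)
Record spanType (N : set V) := SpanType {
  span_val : V; span_valP : span_val \in in_span N }.

HB.instance Definition _ N := [isSub for @span_val N].
HB.instance Definition _ N := [Choice of spanType N by <:].
HB.instance Definition _ N := [SubChoice_isSubLmodule of spanType N by <:].

Lemma mem_gen (N : set V) x : N x -> x \in in_span N.
Proof.
move=> Nx; apply/asboolP; exists [:: (1, x)] => [u|].
  by rewrite inE => /eqP->.
by rewrite big_seq1 scale1r.
Qed.

Definition spanned (N : set V) x (Nx : N x) : spanType N :=
  SpanType (mem_gen Nx).

Definition quot (N : set V) := {ideal_quot in_span N}.

HB.instance Definition _ N := GRing.Zmodule.on (quot N).
HB.instance Definition _ N := Quotient.on (quot N).

Section QuotientScaling.
Variable N : set V.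

Definition quot_scale (k : K) (x : quot N) : quot N :=
  \pi_(quot N) (k *: repr x).

Lemma pi_quotE (x y : V) :
  \pi_(quot N) x = \pi_(quot N) y <-> x - y \in in_span N.
Proof.
have := Quotient.idealrBE (in_span N) x y => ->.
by split=> [/eqP|/eqP].
Qed.

Lemma pi_quotD : {morph \pi_(quot N) : x y / x + y}.
Proof. exact: (@Quotient.pi_add V (in_span N)). Qed.

Lemma quot_scale_pi k x : quot_scale k (\pi_(quot N) x) = \pi_(quot N) (k *: x).
Proof.
apply/pi_quotE; rewrite -scalerBr rpredZ //.
by apply/pi_quotE; rewrite reprK.
Qed.

Lemma quot_reprK (x : quot N) : \pi_(quot N) (repr x) = x.
Proof. exact: reprK. Qed.

Lemma quot_scaleA a b x : quot_scale a (quot_scale b x) = quot_scale (a * b) x.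
Proof. by rewrite -[x]quot_reprK 3!quot_scale_pi scalerA. Qed.

Lemma quot_scale1 : left_id 1 quot_scale.
Proof. by move=> x; rewrite -[x in LHS]quot_reprK quot_scale_pi scale1r quot_reprK. Qed.

Lemma quot_scaleDr : right_distributive quot_scale +%R.
Proof.
move=> a x y; rewrite -[x]quot_reprK -[y]quot_reprK -pi_quotD 3!quot_scale_pi.
by rewrite scalerDr pi_quotD.
Qed.

Lemma quot_scaleDl x : {morph quot_scale^~ x : a b / a + b}.
Proof.
by move=> a b /=; rewrite -[x]quot_reprK 3!quot_scale_pi scalerDl pi_quotD.
Qed.

HB.instance Definition _ := GRing.Zmodule_isLmodule.Build K (quot N)
  quot_scaleA quot_scale1 quot_scaleDr quot_scaleDl.

Definition proj (x : V) : quot N := \pi_(quot N) x.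

Lemma proj_linear : linear proj.
Proof. by move=> k x y; rewrite /proj pi_quotD -quot_scale_pi. Qed.

HB.instance Definition _ :=
  GRing.isLinear.Build K V (quot N) *:%R proj proj_linear.

End QuotientScaling.
End Subspaces.

Section Bilinear.
Variables (K : fieldType) (V W U : lmodType K).

Definition bilin (f : V -> W -> U) : Prop :=
  (forall y, linear (f^~ y)) /\ (forall x, linear (f x)).

End Bilinear.

Section Tensor.
Variables (K : fieldType) (V W : lmodType K).

Definition pure (x : V) (y : W) : {freeg (V * W) / K} := << (x, y) >>.

Definition tensor_rel : set {freeg (V * W) / K} :=
  [set u | exists k x x' y,
     u = pure (k *: x + x') y - (k *: pure x y + pure x' y)] `|`
  [set u | exists k x y y',
     u = pure x (k *: y + y') - (k *: pure x y + pure x y')].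

Definition tensor := quot tensor_rel.
HB.instance Definition _ := GRing.Lmodule.on tensor.
HB.instance Definition _ := Quotient.on tensor.

Definition tens (x : V) (y : W) : tensor := proj tensor_rel (pure x y).

Variable U : lmodType K.

(* For t = \sum_i x_i ⊗ y_i this is \sum_i f x_i y_i. The value is independent
   of the chosen expression of t whenever f is bilinear: see tlift_linear and
   tlift_tens. This is what Sweedler notation stands for. *)
Definition tlift (f : V -> W -> U) (t : tensor) : U :=
  fglift (fun z => f z.1 z.2) (repr t).

End Tensor.

Notation "x ⊗ y" := (tens x y) : ring_scope.
Notation "\tsum_ ( x , y <- t ) F" := (tlift (fun x y => F) t) : ring_scope.

Section TensorTheory.
Variables (K : fieldType) (V W U : lmodType K).
Implicit Types (f : V -> W -> U) (x : V) (y : W).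

Lemma fglift_linear (I : choiceType) (g : I -> U) :
  linear (fglift g : {freeg I / K} -> U).
Proof.
pose h (D : {freeg I / K}) : U := fglift g D.
have hB : zmod_morphism h by exact: lift_is_additive.
pose h' : {additive _ -> _} := HB.pack h (GRing.isZmodMorphism.Build _ _ h hB).
have hZ k D : h (k *: D) = k *: h D.
  have hS (s : seq I) (F : I -> {freeg I / K}) :
    h (\sum_(i <- s) F i) = \sum_(i <- s) h (F i) by exact: (raddf_sum h').
  rewrite -[D]freeg_sumE scaler_sumr !hS scaler_sumr.
  apply: eq_bigr => i _ /=.
  have -> : k *: << coeff i D *g i >> = << k * coeff i D *g i >> :> {freeg I / K}.
    by apply/eqP/freeg_eqP => j; rewrite coeffZ !coeffU mulrA.
  by rewrite /h !liftU scalerA.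
by move=> k D E; rewrite -[LHS]/(h' _) raddfD /= hZ.
Qed.

Lemma tlift_proj f (D : {freeg (V * W) / K}) : bilin f ->
  tlift f (proj (tensor_rel (V:=V) (W:=W)) D) = fglift (fun z => f z.1 z.2) D.
Proof.
move=> [fl fr]; rewrite /tlift; set h := fglift _.
have hl : linear h by exact: fglift_linear.
pose h' : {linear _ -> _} :=
  HB.pack h (GRing.isLinear.Build _ _ _ _ h hl).
have h'E E : h E = h' E by [].
set D' := repr _; apply/eqP; rewrite -subr_eq0 !h'E -raddfB /=.
have : D' - D \in in_span (tensor_rel (V:=V) (W:=W)).
  by apply/pi_quotE; rewrite /D' reprK.
move=> /asboolP[s sN ->]; rewrite -[h _]/(h' _) raddf_sum big_seq big1 // => u us.
rewrite -[LHS]/(h' _) linearZ; suff -> : h' u.2 = 0 by exact: scaler0.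
have hp x y : h' (pure x y) = f x y by rewrite -h'E /h liftU scale1r.
have hZ k x y : h' (k *: pure x y) = k *: f x y.
  by rewrite -hp; exact: linearZ.
case: (sN _ us) => [[k [x [x' [y ->]]]]|[k [x [y [y' ->]]]]];
  rewrite linearB linearD hZ !hp.
- by rewrite (fl y k x x') subrr.
- by rewrite (fr x k y y') subrr.
Qed.

Lemma tlift_tens f x y : bilin f -> tlift f (x ⊗ y) = f x y.
Proof. by move=> fP; rewrite tlift_proj // liftU scale1r. Qed.

Lemma tlift_linear f : bilin f -> linear (tlift f).
Proof.
move=> fP k s t.
have pE (u : tensor V W) : u = proj (tensor_rel (V:=V) (W:=W)) (repr u).
  by rewrite /proj reprK.
rewrite [s in LHS]pE [t in LHS]pE -linearZ -linearD tlift_proj //.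
by rewrite fglift_linear.
Qed.

Lemma tens_bilin : bilin (@tens K V W).
Proof.
split=> [y k x x'|x k y y']; rewrite /tens -linearZ -linearD;
  apply/pi_quotE/mem_gen.
- by left; exists k, x, x', y.
- by right; exists k, x, y, y'.
Qed.

End TensorTheory.

Definition tmap (K : fieldType) (V V' W W' : lmodType K)
    (f : V -> V') (g : W -> W') (t : tensor V W) : tensor V' W' :=
  \tsum_(x, y <- t) f x ⊗ g y.

(* The subspace V ⊗ N of V ⊗ W, for a subspace N of W. *)
Definition tensr (K : fieldType) (V W : lmodType K) (N : set W) :
    set (tensor V W) :=
  span [set t | exists x : V, exists2 y : W, N y & t = x ⊗ y].
Arguments tensr {K} V {W} N.

Record hopf (K : fieldType) (A : algType K) := Hopf {
  comul : {linear A -> tensor A A};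
  counit : {lrmorphism A -> K^o};
  antipode : {linear A -> A};
  comul1 : comul 1 = 1 ⊗ 1;
  comulM : forall a b, comul (a * b) =
    \tsum_(a1, a2 <- comul a) \tsum_(b1, b2 <- comul b) (a1 * b1) ⊗ (a2 * b2);
  comulA : forall a, \tsum_(a1, a2 <- comul a) a1 ⊗ comul a2 =
    \tsum_(a1, a3 <- comul a) \tsum_(a1', a2 <- comul a1) a1' ⊗ (a2 ⊗ a3);
  counitl : forall a, \tsum_(a1, a2 <- comul a) (counit a1 : K) *: a2 = a;
  counitr : forall a, \tsum_(a1, a2 <- comul a) (counit a2 : K) *: a1 = a;
  antipodel : forall a,
    \tsum_(a1, a2 <- comul a) antipode a1 * a2 = (counit a : K) *: 1;
  antipoder : forall a,
    \tsum_(a1, a2 <- comul a) a1 * antipode a2 = (counit a : K) *: 1 }.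

Section Derivations.
Variables (K : fieldType) (B : algType K).

(* Since the actions are K-bilinear and unital, a scalar k%:A of B acts as k on
   both sides. *)
Record bimodule_on (M : lmodType K) := BimoduleOn {
  lact : B -> M -> M;
  ract : M -> B -> M;
  lact_bilin : bilin lact;
  ract_bilin : bilin ract;
  lact1 : forall m, lact 1 m = m;
  ract1 : forall m, ract m 1 = m;
  lactM : forall a b m, lact (a * b) m = lact a (lact b m);
  ractM : forall m a b, ract m (a * b) = ract (ract m a) b;
  lractA : forall a m b, ract (lact a m) b = lact a (ract m b) }.

Record derivation_on (M : lmodType K) := DerivationOn {
  bim :> bimodule_on M;
  der : B -> M;
  der_linear : linear der;
  derM : forall a b, der (a * b) = lact bim a (der b) + ract bim (der a) b }.

Record derivation := Derivation {
  carrier : lmodType K;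
  deriv :> derivation_on carrier }.

Definition adb (M : lmodType K) (d : derivation_on M) (a b : B) : M :=
  lact d a (der d b).

Definition Gamma_gens (d : derivation) : set (carrier d) :=
  [set m | exists a b, m = adb d a b].

Arguments Gamma_gens d : clear implicits.

Definition Gamma (d : derivation) : lmodType K :=
  spanType (Gamma_gens d).

Fact adb_gens (d : derivation) a b : Gamma_gens d (adb d a b).
Proof. by exists a, b. Qed.

Definition adbG (d : derivation) (a b : B) : Gamma d := spanned (adb_gens d a b).

Definition der_le (d' d : derivation) : Prop :=
  exists phi : {linear Gamma d -> Gamma d'},
    forall a b, phi (adbG d a b) = adbG d' a b.

Definition der_eq (d d' : derivation) : Prop := der_le d' d /\ der_le d d'.

Fact mul_bilin : bilin (fun a b : B => a * b).
Proof.
split=> [b k x y|a k x y]; first by rewrite /= mulrDl scalerAl.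
by rewrite mulrDr scalerAr.
Qed.

Definition regular_bimodule : bimodule_on B :=
  @BimoduleOn B _ _ mul_bilin mul_bilin (@mul1r B) (@mulr1 B)
    (fun a b m => esym (mulrA a b m)) (fun m a b => mulrA m a b)
    (fun a m b => esym (mulrA a m b)).

Fact zero_linear : linear (fun _ : B => 0 : B).
Proof. by move=> k x y; rewrite scaler0 addr0. Qed.

Fact zero_derM (a b : B) :
  0 = lact regular_bimodule a 0 + ract regular_bimodule 0 b.
Proof. by rewrite /= mulr0 mul0r addr0. Qed.

Definition zero_derivation : derivation :=
  @Derivation B (@DerivationOn B regular_bimodule _ zero_linear zero_derM).

End Derivations.

Section Calculi.
Variables (K : fieldType) (A : algType K) (H : hopf A).
Variables (P : {pred A}) (B : subAlgType P).
Implicit Types (a : A) (b : B) (R : set A).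

(* The subalgebra is given by its predicate P on A together with the type B of
   its elements, val : B -> A being the inclusion. The algebra structure of B
   carries the derivations; B^+, R, R' and R_d are sets of elements of A. *)

Notation Δ := (comul H).
Notation ε := (fun a : A => counit H a : K).

Definition left_coideal : Prop :=
  forall b, tensr A (range (val : B -> A)) (Δ (val b)).

(* Δ(b) as an element of A ⊗ B: the preimage of Δ(b) under the injection
   A ⊗ B -> A ⊗ A, which exists when B is a left coideal. *)
Definition coact b : tensor A B :=
  xget 0 [set t : tensor A B | tmap id (val : B -> A) t = Δ (val b)].

Definition aplus a : A := a - ε a *: 1.

Definition Bplus : set A := [set x | exists b : B, x = aplus (val b)].

Definition BplusT : lmodType K := spanType Bplus.

Fact bplus_gen b : Bplus (aplus (val b)). Proof. by exists b. Qed.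

Definition bplus b : BplusT := spanned (bplus_gen b).

Definition right_ideal R : Prop :=
  [/\ subspace R, R `<=` Bplus & forall r c, R r -> Bplus c -> R (r * c)].

Definition equivariant (d : derivation B) : Prop :=
  exists phi : {linear Gamma d -> tensor A (Gamma d)}, forall a b : B,
    phi (adbG d a b) =
    \tsum_(a1, a2 <- coact a) \tsum_(b1, b2 <- coact b)
      (a1 * b1) ⊗ adbG d a2 b2.

Section OfIdeal.
Variable R : set A.

Definition BplusQ : lmodType K :=
  quot [set x : BplusT | R (span_val x)].

Definition pR (x : BplusT) : BplusQ := proj _ x.

Definition dR_formula (a b : B) : tensor A BplusQ :=
  \tsum_(b1, b2 <- coact b) (val a * b1) ⊗ pR (bplus b2).

Definition GammaR : lmodType K :=
  spanType [set t | exists a b : B, t = dR_formula a b].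

Definition is_dR (d : derivation_on B GammaR) : Prop :=
  forall a b : B, span_val (adb d a b) = dR_formula a b.

(* For a right ideal R, is_dR determines both the bimodule structure on GammaR
   and the map d; the default value is only there to make dR total. *)
Definition dR : derivation B :=
  match pselect (exists d, is_dR d) with
  | left h => Derivation (projT1 (cid h))
  | right _ => zero_derivation B
  end.

End OfIdeal.

Definition Rd (d : derivation B) : set A :=
  [set x | exists2 s : seq (B * B), \sum_(u <- s) adb d u.1 u.2 = 0 &
     x = \sum_(u <- s) ε (val u.1) *: aplus (val u.2)].

Definition Abar : lmodType K :=
  quot [set x : A | exists2 c, Bplus c & exists a, x = c * a].

Definition bar (a : A) : Abar := proj _ a.

Definition Deltabar (a : A) : tensor Abar A := tmap bar id (Δ a).

Definition Rprime R : set A := Deltabar @^-1` (tensr Abar R).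

End Calculi.

Arguments Bplus {K A} H {P} B.
Arguments left_coideal {K A} H {P} B.
Arguments right_ideal {K A} H {P} B R.
Arguments equivariant {K A} H {P B} d.
Arguments GammaR {K A} H {P} B R.
Arguments is_dR {K A H P B R} d.
Arguments dR {K A} H {P} B R.
Arguments Rd {K A} H {P B} d.
Arguments Abar {K A} H {P} B.
Arguments Deltabar {K A} H {P} B a.
Arguments Rprime {K A} H {P} B R.

(* Main.v *)
Require Import Defs.
From HB Require Import structures.
From mathcomp Require Import all_boot all_algebra.
From mathcomp Require Import boolp classical_sets reals complex.
From mathcomp Require Import freeg.

Set Implicit Arguments.
Unset Strict Implicit.
Unset Printing Implicit Defensive.

Import GRing.Theory.

Local Open Scope classical_set_scope.
Local Open Scope ring_scope.
Local Open Scope complex_scope.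

(** Why the theorem is true.

    For a linear functional f on A write [rho f x] for f(x_(1)) x_(2). As
    functionals separate the elements of a tensor product over a field, an
    element of V ⊗ W lies in V ⊗ N exactly when all its slices, obtained by
    applying a functional to the first leg, lie in N ([tensrP]). Slicing turns
    every condition of the theorem into a family of conditions on elements of
    A, in which no tensor occurs.

    A derivation d only matters through its relations, the finite families
    (a_i, b_i) with Σ a_i d b_i = 0: the order on derivations is reversed
    inclusion of relations ([der_leP]). Put
      [relform f a b] = f(a b_(1)) b_(2)^+.
    Three facts express everything through this form:
    - (a_i, b_i) is a relation of d_R iff Σ relform f a_i b_i is in R for every
      functional f on A ([dR_rel]);
    - R_d consists of the sums Σ relform ε a_i b_i over the relations of d
      ([RdP]);
    - d is equivariant iff, for every f, its relations are stable under
      a ⊗ b ↦ f(a_(1) b_(1)) a_(2) ⊗ b_(2) ([equivariantP]), and this operation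
      carries [relform g] to [relform (g \o rho f)] ([coform_relform]); in
      particular it carries [relform ε] to [relform f].
    Hence d_R is equivariant; taking f = ε gives R_{d_R} ⊆ R; and for an
    equivariant d every relation of d is one of d_{R_d}, that is
    d_{R_d} ≤ d. In terms of relations both constructions are monotone, so
    these two facts make them a Galois connection between right ideals and
    equivariant derivations, and part (iii) is the bijection between the closed
    elements of its two sides.

    For R', note that the functionals on the quotient of A by B^+ A are the
    functionals g on A with g(b y) = ε(b) g(y) for b in B. So r is in R' iff
    rho g r is in R for all such g ([RprimeP]). These g satisfy
    rho g (relform f a b) = relform (g \o rho f) a b, by which d_R and d_{R'}
    have the same relations ([dR_Rprime]), and also
    relform g a b = ε(a) rho g (b^+), which gives the second half of (ii)
    ([Rd_stable]).

    The bimodule structure of Γ(d_R) is forced on generators; it exists because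
    the relations of d_R are stable under left multiplication and under the
    Leibniz rule ([der_form_exists], [dR_exists]). *)

(** * Separating functionals *)

Definition lin (K : fieldType) (V W : lmodType K) (f : V -> W)
  (fP : linear f) : {linear V -> W} :=
  HB.pack f (GRing.isLinear.Build K V W *:%R f fP).

Section Separation.
Variables (K : fieldType) (V : lmodType K).
Implicit Types (N : set V) (x y v : V).

Lemma subspaceD N x y : subspace N -> N x -> N y -> N (x + y).
Proof. by move=> [_ NL] Nx Ny; rewrite -[x]scale1r; exact: NL. Qed.

Lemma subspaceZ N k x : subspace N -> N x -> N (k *: x).
Proof. by move=> [N0 NL] Nx; rewrite -[_ *: _]addr0; exact: NL. Qed.

Lemma subspaceB N x y : subspace N -> N x -> N y -> N (x - y).
Proof.
move=> Ns Nx Ny; apply: subspaceD => //.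
by rewrite -scaleN1r; exact: subspaceZ.
Qed.

Lemma subspace_sum N (I : eqType) (s : seq I) (F : I -> V) : subspace N ->
  (forall i, i \in s -> N (F i)) -> N (\sum_(i <- s) F i).
Proof.
move=> Ns NF; rewrite big_seq; apply: (big_ind N) => //; first by case: Ns.
by move=> x y; exact: subspaceD.
Qed.

Lemma span_subspace N : subspace (Defs.span N).
Proof.
have := in_span_closed N => -[N0 NL]; split; first exact/asboolP.
by move=> k x y /asboolP Nx /asboolP Ny; apply/asboolP/NL.
Qed.

Lemma span_min N M : subspace M -> N `<=` M -> Defs.span N `<=` M.
Proof.
move=> Ms NM _ [s sN ->]; apply: subspace_sum => // u /sN/NM.
exact: subspaceZ.
Qed.

Lemma sub_span N : N `<=` Defs.span N.
Proof. by move=> x /mem_gen/asboolP. Qed.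

Lemma in_spanE N x : subspace N -> (x \in in_span N) = `[< N x >].
Proof.
move=> Ns; apply/asboolP/asboolP; first exact: span_min.
exact: sub_span.
Qed.

(** Zorn's lemma provides a subspace M that contains N and is maximal for not
    containing v. Adjoining any further x to M produces v, so M is a
    hyperplane complementary to the line of v. *)
Lemma maximal_avoiding N v : subspace N -> ~ N v ->
  exists M, [/\ subspace M, N `<=` M, ~ M v &
    forall x, exists k, M (x - k *: v)].
Proof.
move=> Ns Nv; pose good M := [/\ subspace M, N `<=` M & ~ M v].
have [|A [AP Amax]] := @Zorn_bigcup V [set M | M = set0 \/ good M].
  (* set0 is admitted because the union of an empty chain is empty. *)
  move=> F FP Ftot; have [[X0 FX0 gX0]|nF] := pselect (exists2 X, F X & good X).
    right; split.
    - split; first by exists X0 => //; case: gX0 => -[].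
      move=> k x y [X FX Xx] [Y FY Yy].
      have gd Z z : F Z -> Z z -> good Z.
        by move=> /FP[->|].
      have [XY|YX] := Ftot _ _ FX FY.
        by exists Y => //; have [[_ ZL] _ _] := gd _ _ FY Yy; apply: ZL => //; exact: XY.
      by exists X => //; have [[_ ZL] _ _] := gd _ _ FX Xx; apply: ZL => //; exact: YX.
    - by move=> x Nx; exists X0 => //; case: gX0 => _ /(_ _ Nx).
    - by move=> [X FX Xv]; have [X0E|[_ _]] := FP _ FX; [move: Xv; rewrite X0E|apply].
  left; apply/seteqP; split=> [x [X FX Xx]|//].
  have [X0E|gX] := FP _ FX; first by move: Xx; rewrite X0E.
  by case: nF; exists X.
have gA : good A.
  case: AP => // A0; exfalso; apply: (Amax N); last by right; split.
  by rewrite A0; split=> [x []|NA]; case: Ns => N0 _; exact: (NA _ N0).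
have [As NA Av] := gA; exists A; split => // x.
have [Ax|Ax] := pselect (A x); first by exists 0; rewrite scale0r subr0.
pose A' := [set y | exists c, A (y - c *: x)].
have A's : subspace A'.
  split; first by exists 0; rewrite scale0r subr0; case: As.
  move=> k y z [c cP] [d dP]; exists (k * c + d).
  suff -> : k *: y + z - (k * c + d) *: x = k *: (y - c *: x) + (z - d *: x).
    by case: As => _; apply.
  by rewrite scalerBr scalerDl scalerA opprD addrACA.
have AA' : A `<=` A' by move=> y Ay; exists 0; rewrite scale0r subr0.
have [[c cP]|A'v] := pselect (A' v); last first.
  exfalso; apply: (Amax A'); last by right; split=> // y /NA/AA'.
  by split=> // /(_ x) xA; apply: Ax; apply: xA; exists 1; rewrite scale1r subrr; case: As.
have c0 : c != 0.
  by apply/eqP => c0; apply: Av; move: cP; rewrite c0 scale0r subr0.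
exists c^-1; have -> : x - c^-1 *: v = - c^-1 *: (v - c *: x).
  by rewrite scaleNr scalerBr scalerA mulVf // scale1r opprB.
exact: subspaceZ.
Qed.

(** The functional is the coordinate along v modulo the hyperplane of
    [maximal_avoiding]. *)
Lemma separation N v : subspace N -> ~ N v ->
  exists2 f : {linear V -> K^o}, f v = 1 & forall x, N x -> f x = 0.
Proof.
move=> Ns /(maximal_avoiding Ns)[M [Ms NM Mv /choice[f fP]]].
have uniq x k : M (x - k *: v) -> f x = k.
  move=> xk; have [//|] := eqVneq (f x) k; rewrite -subr_eq0 => fk; case: Mv.
  rewrite -[v]scale1r -(mulVf fk) -scalerA; apply: subspaceZ => //.
  suff -> : (f x - k) *: v = (x - k *: v) - (x - f x *: v) by exact: subspaceB.
  by rewrite opprB [RHS]addrC addrA subrK scalerBl.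
have fl : linear (f : V -> K^o).
  move=> k x y; apply: uniq.
  have -> : k *: x + y - (k *: (f x : K^o) + f y) *: v =
    k *: (x - f x *: v) + (y - f y *: v).
    by rewrite scalerBr scalerDl -scalerA opprD addrACA.
  by case: Ms => _; apply.
exists (lin fl) => [|x Nx] /=; apply: uniq.
  by rewrite scale1r subrr; case: Ms.
by rewrite scale0r subr0; exact: NM.
Qed.

End Separation.

(** * Bilinear maps and slices of tensors *)

Section Bilinearity.
Variables (K : fieldType) (V W U : lmodType K).

Lemma bilin_pre (V' W' : lmodType K) (f : V -> W -> U)
    (g : {linear V' -> V}) (h : {linear W' -> W}) :
  bilin f -> bilin (fun x y => f (g x) (h y)).
Proof.
move=> [fl fr]; split=> [y k x x'|x k y y'] /=; rewrite linearP.
  exact: (fl _ k).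
exact: (fr _ k).
Qed.

Lemma bilin0l (f : V -> W -> U) y : bilin f -> f 0 y = 0.
Proof. by move=> [fl _]; rewrite -[LHS]/(lin (fl y) 0) linear0. Qed.

Lemma bilin0r (f : V -> W -> U) x : bilin f -> f x 0 = 0.
Proof. by move=> [_ fr]; rewrite -[LHS]/(lin (fr x) 0) linear0. Qed.

Lemma bilinZl (f : V -> W -> U) k x y : bilin f -> f (k *: x) y = k *: f x y.
Proof. by move=> [fl _]; rewrite -[LHS]/(lin (fl y) _) linearZ. Qed.

Lemma bilin_suml (f : V -> W -> U) (I : Type) (s : seq I) F y : bilin f ->
  f (\sum_(i <- s) F i) y = \sum_(i <- s) f (F i) y.
Proof. by move=> [fl _]; rewrite -[LHS]/(lin (fl y) _) linear_sum. Qed.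

Lemma bilin_sumr (f : V -> W -> U) (I : Type) (s : seq I) F x : bilin f ->
  f x (\sum_(i <- s) F i) = \sum_(i <- s) f x (F i).
Proof. by move=> [_ fr]; rewrite -[LHS]/(lin (fr x) _) linear_sum. Qed.

Lemma bilin_scale (f : {linear V -> K^o}) : bilin (fun x (y : W) => (f x : K) *: y).
Proof.
split=> [y k x x'|x k y y'] /=.
  by rewrite linearP scalerDl -[k *: (_ : K^o)]/(k * (f x : K)) scalerA.
by rewrite scalerDr !scalerA mulrC.
Qed.

Lemma tlift_sum (f : V -> W -> U) (I : Type) (s : seq I) F : bilin f ->
  tlift f (\sum_(i <- s) F i) = \sum_(i <- s) tlift f (F i).
Proof. by move=> fP; rewrite -[LHS]/(lin (tlift_linear fP) _) linear_sum. Qed.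

Lemma tlift_tsum (f : V -> W -> U) (s : seq (V * W)) : bilin f ->
  tlift f (\sum_(u <- s) u.1 ⊗ u.2) = \sum_(u <- s) f u.1 u.2.
Proof.
move=> fP; rewrite tlift_sum //; apply: eq_bigr => u _.
by rewrite tlift_tens.
Qed.

End Bilinearity.

Section TensorSums.
Variables (K : fieldType) (V W : lmodType K).

Lemma tensZl k (x : V) (y : W) : (k *: x) ⊗ y = k *: (x ⊗ y).
Proof. exact: (bilinZl k x y (tens_bilin V W)). Qed.

Lemma tens_sum (t : tensor V W) : exists s : seq (V * W),
  t = \sum_(u <- s) u.1 ⊗ u.2.
Proof.
have -> : t = proj (tensor_rel (V:=V) (W:=W)) (repr t) by rewrite /proj reprK.
elim/freeg_rect_dom0: (repr t) => [|k z D zD k0 [s IHs]].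
  by exists [::]; rewrite linear0 big_nil.
exists ((k *: z.1, z.2) :: s); rewrite big_cons linearD /= IHs; congr (_ + _).
rewrite tensZl /tens -linearZ; case: z {zD} => x y; congr (proj _ _).
apply/eqP/freeg_eqP => j.
by rewrite coeffZ !coeffU mul1r.
Qed.

End TensorSums.

Section Slices.
Variables (K : fieldType) (V W : lmodType K).
Implicit Types (f : {linear V -> K^o}) (t : tensor V W).

Definition slice f t : W := \tsum_(x, y <- t) (f x : K) *: y.

Lemma slice_linear f : linear (slice f).
Proof. exact/tlift_linear/bilin_scale. Qed.

HB.instance Definition _ f :=
  GRing.isLinear.Build K (tensor V W) W *:%R (slice f) (slice_linear f).

Lemma slice_tens f x y : slice f (x ⊗ y) = (f x : K) *: y.
Proof. exact/tlift_tens/bilin_scale. Qed.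

Lemma slice_tsum f (s : seq (V * W)) :
  slice f (\sum_(u <- s) u.1 ⊗ u.2) = \sum_(u <- s) (f u.1 : K) *: u.2.
Proof. exact/tlift_tsum/bilin_scale. Qed.

Lemma tensr_subspace (N : set W) : subspace (tensr V N).
Proof. exact: span_subspace. Qed.

Lemma tensr_tens (N : set W) (x : V) y : N y -> tensr V N (x ⊗ y).
Proof. by move=> Ny; apply: sub_span; exists x, y. Qed.

Lemma tensr_slice (N : set W) t f : subspace N ->
  tensr V N t -> N (slice f t).
Proof.
move=> Ns; move: t; apply: span_min => [|_ [x [y Ny ->]]]; last first.
  by rewrite /= slice_tens; exact: subspaceZ.
split=> [|k s t Ns' Nt] /=; first by rewrite linear0; case: Ns.
by rewrite linearP; case: Ns => _; exact.
Qed.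

(** Induct on the number of pure tensors needed to write t modulo V ⊗ N. If the
    first leg x of one of them is a combination of the other first legs, that
    term can be absorbed; otherwise slice by a functional that is 1 at x and 0
    at the other first legs: the slice differs from y by an element of N, so
    x ⊗ y is itself in V ⊗ N. *)
Lemma tensrP (N : set W) t : subspace N ->
  tensr V N t <-> forall f, N (slice f t).
Proof.
move=> Ns; split=> [Nt f|Nt]; first exact: tensr_slice.
have Ts := tensr_subspace N.
suff red n (F : 'I_n -> V * W) :
    tensr V N (t - \sum_(i < n) (F i).1 ⊗ (F i).2) -> tensr V N t.
  have [s tE] := tens_sum t; apply: (red (size s) (tnth (in_tuple s))).
  by rewrite tE big_tnth subrr; case: Ts.
elim: n F => [|n IHn] F; first by rewrite big_ord0 subr0.
rewrite big_ord_recl; set x := (F ord0).1; set y := (F ord0).2.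
pose G (i : 'I_n) := F (fintype.lift ord0 i); rewrite -/x -/y.
under eq_bigr do rewrite -/(G _).
pose M := [set z | exists c : 'I_n -> K, z = \sum_i c i *: (G i).1].
have Ms : subspace M.
  split=> [|k _ _ [c ->] [d ->]].
    by exists (fun=> 0); rewrite big1 // => i _; rewrite scale0r.
  exists (fun i => k * c i + d i); rewrite scaler_sumr -big_split /=.
  by apply: eq_bigr => i _; rewrite scalerDl scalerA.
have MG i : M (G i).1.
  exists (fun j => (j == i)%:R); rewrite (bigD1 i) //= eqxx scale1r big1 ?addr0 //.
  by move=> j /negPf->; rewrite scale0r.
have [_ tr] := tens_bilin V W.
have [[c xE]|/(separation Ms)[f fx fM]] := pselect (M x).
  move=> Nt'; apply: (IHn (fun i => ((G i).1, c i *: y + (G i).2))) => /=.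
  move: Nt'; rewrite xE (bilin_suml _ _ _ (tens_bilin V W)).
  rewrite -big_split /=; congr (tensr V N (t - _)); apply: eq_bigr => i _.
  by rewrite (tr _ (c i)) tensZl.
move=> Nt'; apply: (IHn G).
have Ny : N y.
  have := tensr_slice f Ns Nt'; rewrite !linearB /= linearD /= slice_tens fx scale1r.
  rewrite linear_sum /= big1 => [|i _]; last by rewrite slice_tens fM ?scale0r.
  rewrite addr0 => Nty; have -> : y = slice f t - (slice f t - y).
    by rewrite opprB addrC subrK.
  exact: subspaceB.
have -> : t - \sum_i (G i).1 ⊗ (G i).2 =
  (t - (x ⊗ y + \sum_i (G i).1 ⊗ (G i).2)) + x ⊗ y.
  by rewrite opprD addrA addrAC subrK.
by apply: subspaceD => //; exact: tensr_tens.
Qed.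

Lemma slice0P t : (forall f, slice f t = 0) -> t = 0.
Proof.
move=> t0; have s0 : subspace [set 0 : W].
  by split=> // k x y -> ->; rewrite scaler0 addr0.
have /(tensrP t s0) : forall f, [set 0] (slice f t) by [].
apply: (@span_min K (tensor V W) _ [set 0]).
  by split=> // k x y -> ->; rewrite scaler0 addr0.
by move=> _ [x [_ -> ->]]; exact: bilin0r (tens_bilin V W).
Qed.

Lemma slice_inj s t : (forall f, slice f s = slice f t) -> s = t.
Proof.
move=> st; apply/eqP; rewrite -subr_eq0; apply/eqP/slice0P => f.
by rewrite linearB /= st subrr.
Qed.

End Slices.

Section TensorMaps.
Variables (K : fieldType) (V V' W W' : lmodType K).
Variables (g : {linear V -> V'}) (h : {linear W -> W'}).

Lemma tmap_bilin : bilin (fun x y => g x ⊗ h y).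
Proof. exact/bilin_pre/tens_bilin. Qed.

Lemma tmap_tsum (s : seq (V * W)) :
  tmap g h (\sum_(u <- s) u.1 ⊗ u.2) = \sum_(u <- s) g u.1 ⊗ h u.2.
Proof. exact/tlift_tsum/tmap_bilin. Qed.

(** The functional f' stands for f \o g; it is a separate argument because the
    applications need it as a functional that has a name, and not as this
    composite. *)
Lemma slice_tmap (f : {linear V' -> K^o}) (f' : {linear V -> K^o}) t :
  (forall x, f (g x) = f' x) -> slice f (tmap g h t) = h (slice f' t).
Proof.
move=> ff'; have [s ->] := tens_sum t.
rewrite tmap_tsum slice_tsum !linear_sum; apply: eq_bigr => u _.
by rewrite /= !slice_tens ff' linearZ.
Qed.

End TensorMaps.

(** * Spaces generated by the values of a bilinear map *)

Definition bsum (K : fieldType) (V W U : lmodType K) (f : V -> W -> U)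
  (s : seq (V * W)) : U := \sum_(u <- s) f u.1 u.2.

Definition gens (K : fieldType) (V W U : lmodType K) (f : V -> W -> U) : set U :=
  [set m | exists a b, m = f a b].

Definition gen (K : fieldType) (V W U : lmodType K) (f : V -> W -> U) a b :
    spanType (gens f) :=
  spanned (ex_intro _ a (ex_intro _ b erefl)).

Lemma span_val_sum (K : fieldType) (V : lmodType K) (N : set V) (I : Type)
    (s : seq I) (F : I -> spanType N) :
  span_val (\sum_(i <- s) F i) = \sum_(i <- s) span_val (F i).
Proof. by rewrite -[LHS]/(val _) raddf_sum. Qed.

Section GeneratedSpace.
Variables (K : fieldType) (V W M : lmodType K).
Variable D : V -> W -> M.
Hypothesis Dbil : bilin D.
Implicit Types s : seq (V * W).

Lemma bsum_cat s t : bsum D (s ++ t) = bsum D s + bsum D t.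
Proof. by rewrite /bsum big_cat. Qed.

Lemma bsumZ k s : bsum D [seq (k *: u.1, u.2) | u <- s] = k *: bsum D s.
Proof.
rewrite /bsum big_map scaler_sumr; apply: eq_bigr => u _.
by rewrite (bilinZl _ _ _ Dbil).
Qed.

Lemma gen_bilin : bilin (gen D).
Proof.
case: Dbil => Dl Dr; split=> [b k x y|a k x y]; apply: val_inj => /=.
  exact: Dl.
exact: Dr.
Qed.

Lemma span_val_bsum s : span_val (bsum (gen D) s) = bsum D s.
Proof. exact: span_val_sum. Qed.

Lemma gen_span (m : spanType (gens D)) : exists s, m = bsum (gen D) s.
Proof.
case: m => m mP; have /asboolP[s] := mP.
elim: s m mP => [|u s IHs] m mP sN mE.
  by exists [::]; apply: val_inj; rewrite /bsum big_nil /= mE big_nil.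
have [a [b uE]] := sN u (mem_head u s).
have m'P : \sum_(v <- s) v.1 *: v.2 \in in_span (gens D).
  by apply/asboolP; exists s => // v vs; apply: sN; rewrite inE vs orbT.
have [|t tE] := IHs _ m'P _ erefl.
  by move=> v vs; apply: sN; rewrite inE vs orbT.
exists ((u.1 *: a, b) :: t); rewrite /bsum big_cons -/(bsum _ _) -tE.
by apply: val_inj; rewrite /= mE big_cons uE (bilinZl _ _ _ Dbil).
Qed.

Lemma bsum_gen0 s : bsum (gen D) s = 0 <-> bsum D s = 0.
Proof.
split=> [Gs|Ds]; first by rewrite -span_val_bsum Gs.
by apply: val_inj; rewrite /= span_val_bsum Ds.
Qed.

End GeneratedSpace.

Section WellDefinedMaps.
Variables (K : fieldType) (V W M U : lmodType K).
Variables (D : V -> W -> M) (β : V -> W -> U).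
Hypotheses (Dbil : bilin D) (βbil : bilin β).
Implicit Types s : seq (V * W).

Lemma bsum_lin (phi : {linear spanType (gens D) -> U}) s :
  (forall a b, phi (gen D a b) = β a b) -> phi (bsum (gen D) s) = bsum β s.
Proof.
by move=> phiE; rewrite /bsum linear_sum; apply: eq_bigr => u _.
Qed.

(** This is what it means for D a b ↦ β a b to be well defined: every relation
    between the generators D a b also holds between the β a b. *)
Lemma gen_lift : (forall s, bsum D s = 0 -> bsum β s = 0) ->
  exists phi : {linear spanType (gens D) -> U},
    forall a b, phi (gen D a b) = β a b.
Proof.
move=> wd; have wdE s t : bsum D s = bsum D t -> bsum β s = bsum β t.
  move=> st; apply/eqP; rewrite -subr_eq0 addrC -scaleN1r; apply/eqP.
  rewrite -bsumZ // -bsum_cat; apply: wd.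
  by rewrite bsum_cat bsumZ // st scaleN1r addNr.
have /choice[r rP] := gen_span Dbil.
have rE s : bsum β (r (bsum (gen D) s)) = bsum β s.
  by apply: wdE; rewrite -span_val_bsum -rP span_val_bsum.
have fl : linear (fun m => bsum β (r m)).
  move=> k m m'; rewrite [m in LHS]rP [m' in LHS]rP.
  by rewrite -(bsumZ (gen_bilin Dbil)) -bsum_cat rE bsum_cat (bsumZ βbil).
exists (lin fl) => a b /=; have -> : gen D a b = bsum (gen D) [:: (a, b)].
  by rewrite /bsum big_seq1.
by rewrite rE /bsum big_seq1.
Qed.

Lemma gen_liftP : (exists phi : {linear spanType (gens D) -> U},
    forall a b, phi (gen D a b) = β a b) <->
  (forall s, bsum D s = 0 -> bsum β s = 0).
Proof.
split=> [[phi phiE] s Ds|]; last exact: gen_lift.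
by rewrite -(bsum_lin _ phiE) (bsum_gen0 _ _).2 // linear0.
Qed.

End WellDefinedMaps.

(** * The derivation generated by a bilinear form *)

Section DerivationOfForm.
Variables (K : fieldType) (B : algType K) (M : lmodType K).
Variable D : B -> B -> M.
Hypothesis Dbil : bilin D.
Local Notation Γ := (spanType (gens D)).

Lemma bimodule_on_eq (N : lmodType K) (b1 b2 : bimodule_on B N) :
  lact b1 = lact b2 -> ract b1 = ract b2 -> b1 = b2.
Proof.
case: b1 => l1 r1 ? ? ? ? ? ? ?; case: b2 => l2 r2 ? ? ? ? ? ? ? /= El Er.
by subst; congr BimoduleOn; exact: Prop_irrelevance.
Qed.

Lemma derivation_on_eq (N : lmodType K) (d1 d2 : derivation_on B N) :
  bim d1 = bim d2 -> der d1 = der d2 -> d1 = d2.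
Proof.
case: d1 => b1 e1 ? ?; case: d2 => b2 e2 ? ? /= Eb Ee.
by subst; congr DerivationOn; exact: Prop_irrelevance.
Qed.

(** The actions are forced on generators: c (D a b) = D (c a) b, and the Leibniz
    rule gives (D a b) c = D a (b c) - D (a b) c. *)
Lemma der_form_uniq (d1 d2 : derivation_on B Γ) :
  (forall a b, adb d1 a b = gen D a b) ->
  (forall a b, adb d2 a b = gen D a b) -> d1 = d2.
Proof.
move=> d1E d2E.
have derE (d : derivation_on B Γ) (dE : forall a b, adb d a b = gen D a b) b :
    der d b = gen D 1 b.
  by rewrite -dE /adb lact1.
have lactE (d : derivation_on B Γ) (dE : forall a b, adb d a b = gen D a b) c s :
    lact d c (bsum (gen D) s) = bsum (fun a b => gen D (c * a) b) s.
  rewrite /bsum (bilin_sumr _ _ _ (lact_bilin d)); apply: eq_bigr => u _.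
  by rewrite -!dE /adb lactM.
have ractE (d : derivation_on B Γ) (dE : forall a b, adb d a b = gen D a b) c s :
    ract d (bsum (gen D) s) c =
    bsum (fun a b => gen D a (b * c) - gen D (a * b) c) s.
  rewrite /bsum (bilin_suml _ _ _ (ract_bilin d)); apply: eq_bigr => u _.
  rewrite -!dE /adb lractA derM lactM.
  rewrite -[lact d _ (_ + _)]/(lin ((lact_bilin d).2 _) _) linearD /=.
  by rewrite addrC addKr.
apply: derivation_on_eq; last by apply/funext => b; rewrite !derE.
apply: bimodule_on_eq; apply/funext => x; apply/funext => y.
  by have [s ->] := gen_span Dbil y; rewrite !lactE.
by have [s ->] := gen_span Dbil x; rewrite !ractE.
Qed.

(* D a b will be the value of a d b, so these are the consequences of the
   bimodule axioms and of the Leibniz rule that mention D only. *)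
Hypothesis D1 : forall a, D a 1 = 0.
Hypothesis Dleft : forall c s, bsum D s = 0 -> bsum (fun a b => D (c * a) b) s = 0.
Hypothesis Dright : forall c s, bsum D s = 0 ->
  bsum (fun a b => D a (b * c) - D (a * b) c) s = 0.

(** [Dleft] and [Dright] make the two forced actions well defined; the bimodule
    axioms are then identities between generators. *)
Lemma der_form_exists : exists d : derivation_on B Γ,
  forall a b, adb d a b = gen D a b.
Proof.
have [gl gr] := gen_bilin Dbil.
have gen1 a : gen D a 1 = 0 by apply: val_inj; exact: D1.
have /choice[L LE] : forall c, exists phi : {linear Γ -> Γ},
    forall a b, phi (gen D a b) = gen D (c * a) b.
  move=> c; apply/gen_lift => //.
    split=> [b k x y|a k x y] /=; last exact: gr.
    by rewrite mulrDr -scalerAr (gl b).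
  move=> s /(Dleft c) Ds; apply: val_inj.
  by rewrite /bsum /= span_val_sum; exact: Ds.
have /choice[R RE] : forall c, exists phi : {linear Γ -> Γ},
    forall a b, phi (gen D a b) = gen D a (b * c) - gen D (a * b) c.
  move=> c; apply/gen_lift => //.
    split=> [b k x y|a k x y] /=.
      by rewrite mulrDl -scalerAl !(gl _ k) scalerBr opprD addrACA.
    by rewrite mulrDl -scalerAl mulrDr -scalerAr (gr a) (gl c) scalerBr opprD addrACA.
  move=> s /(Dright c) Ds; apply: val_inj.
  by rewrite /bsum /= span_val_sum; exact: Ds.
have lact_bil : bilin (fun c m => L c m).
  split=> [m k c c'|c k m m'] /=; last by rewrite linearP.
  have [s ->] := gen_span Dbil m; rewrite /bsum !linear_sum -big_split.
  by apply: eq_bigr => u _; rewrite /= !LE mulrDl -scalerAl (gl u.2).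
have ract_bil : bilin (fun m c => R c m).
  split=> [c k m m'|m k c c'] /=; first by rewrite linearP.
  have [s ->] := gen_span Dbil m; rewrite /bsum !linear_sum -big_split.
  apply: eq_bigr => u _; rewrite /= !RE mulrDr -scalerAr !(gr _ k).
  by rewrite scalerBr opprD addrACA.
have L1 m : L 1 m = m.
  have [s ->] := gen_span Dbil m; rewrite /bsum !linear_sum.
  by apply: eq_bigr => u _; rewrite LE mul1r.
have R1 m : R 1 m = m.
  have [s ->] := gen_span Dbil m; rewrite /bsum !linear_sum.
  by apply: eq_bigr => u _; rewrite RE mulr1 gen1 subr0.
have LM a b m : L (a * b) m = L a (L b m).
  have [s ->] := gen_span Dbil m; rewrite /bsum !linear_sum.
  by apply: eq_bigr => u _; rewrite !LE mulrA.
have RM m a b : R (a * b) m = R b (R a m).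
  have [s ->] := gen_span Dbil m; rewrite /bsum !linear_sum.
  apply: eq_bigr => u _; rewrite !RE linearB /= !RE !mulrA.
  by rewrite opprB addrA subrK.
have LR a m b : R b (L a m) = L a (R b m).
  have [s ->] := gen_span Dbil m; rewrite /bsum !linear_sum.
  by apply: eq_bigr => u _; rewrite LE !RE linearB /= !LE mulrA.
pose bm := BimoduleOn lact_bil ract_bil L1 R1 LM RM LR.
have dM a b : gen D 1 (a * b) = lact bm a (gen D 1 b) + ract bm (gen D 1 a) b.
  by rewrite /= LE RE mulr1 mul1r addrC subrK.
exists (DerivationOn (gr 1) dM) => a b.
by rewrite /adb /= LE mulr1.
Qed.

End DerivationOfForm.

(** * The order on derivations in terms of relations *)

Section Relations.
Variables (K : fieldType) (B : algType K).
Implicit Types d : derivation B.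

Lemma adb_bilin (M : lmodType K) (d : derivation_on B M) : bilin (adb d).
Proof.
exact: (bilin_pre idfun (lin (der_linear d)) (lact_bilin d)).
Qed.

Lemma adbGE d a b : adbG d a b = gen (adb d) a b.
Proof. exact: val_inj. Qed.

Lemma der_leP d' d :
  der_le d' d <-> forall s, bsum (adb d) s = 0 -> bsum (adb d') s = 0.
Proof.
have [lr rl] := gen_liftP (adb_bilin d) (gen_bilin (adb_bilin d')).
split=> [[phi phiE] s Ds|dd'].
  apply/bsum_gen0; apply: lr Ds; exists phi => a b.
  by rewrite -!adbGE.
have [|phi phiE] := rl; first by move=> s /dd' Ds; apply/bsum_gen0.
by exists phi => a b; rewrite !adbGE.
Qed.

End Relations.

(** * Slices of the comultiplication *)

Lemma quot_lift (K : fieldType) (V U : lmodType K) (N : set V)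
    (g : {linear V -> U}) : (forall x, N x -> g x = 0) ->
  exists phi : {linear quot N -> U}, forall x, phi (proj N x) = g x.
Proof.
move=> gN; have gE x y : proj N x = proj N y -> g x = g y.
  move=> /pi_quotE/asboolP[s sN xy]; apply/eqP.
  rewrite -subr_eq0 -linearB xy linear_sum big_seq big1 //= => u /sN/gN ug.
  by rewrite linearZ_LR ug scaler0.
have rE x : g (repr (proj N x)) = g x by apply: gE; rewrite /proj reprK.
have fl : linear (fun x : quot N => g (repr x)).
  move=> k x y; rewrite -[RHS]linearP; apply: gE.
  by rewrite linearP /= /proj !reprK.
by exists (lin fl).
Qed.

Section Functionals.
Variables (K : fieldType) (V W : lmodType K).

Lemma funcZ (f : {linear V -> K^o}) k x : (f (k *: x) : K) = k * (f x : K).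
Proof. by rewrite linearZ_LR. Qed.

Lemma slice_comb (I : Type) (s : seq I) (c : I -> K) (f : {linear V -> K^o})
    (F : I -> {linear V -> K^o}) (t : tensor V W) :
  (forall x, f x = \sum_(i <- s) c i * F i x :> K) ->
  slice f t = \sum_(i <- s) c i *: slice (F i) t.
Proof.
move=> fE; have [r ->] := tens_sum t; rewrite slice_tsum.
under [RHS]eq_bigr do rewrite slice_tsum scaler_sumr.
rewrite exchange_big; apply: eq_bigr => u _ /=.
by rewrite fE scaler_suml; apply: eq_bigr => i _; rewrite scalerA.
Qed.

End Functionals.

Section Translates.
Variables (K : fieldType) (A : algType K).
Implicit Types (f : {linear A -> K^o}) (a : A).

Fact ltr_linear f a : linear (fun x => f (a * x) : K^o).
Proof. by move=> k x y; rewrite mulrDr -scalerAr linearP. Qed.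

Definition ltr f a : {linear A -> K^o} := lin (ltr_linear f a).

Fact rtr_linear f a : linear (fun x => f (x * a) : K^o).
Proof. by move=> k x y; rewrite mulrDl -scalerAl linearP. Qed.

Definition rtr f a : {linear A -> K^o} := lin (rtr_linear f a).

End Translates.

Section HopfSlices.
Variables (K : fieldType) (A : algType K) (H : hopf A).
Implicit Types (f g : {linear A -> K^o}) (a x y : A).

Local Notation Δ := (comul H).
Local Notation ε a := (counit H a : K).

(** In Sweedler notation this is f(x_(1)) x_(2). *)
Definition rho f x : A := slice f (Δ x).

Lemma rho_linear f : linear (rho f).
Proof. by move=> k x y; rewrite /rho !linearP. Qed.

HB.instance Definition _ f :=
  GRing.isLinear.Build K A A *:%R (rho f) (rho_linear f).

Lemma rho_counit x : rho (counit H : {linear A -> K^o}) x = x.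
Proof. exact: counitl. Qed.

Lemma counitr_sum x (s : seq (A * A)) : Δ x = \sum_(u <- s) u.1 ⊗ u.2 ->
  x = \sum_(u <- s) ε u.2 *: u.1.
Proof.
move=> xE; rewrite -[LHS](counitr H) xE tlift_tsum //.
split=> [y k a b|a k y z] /=; first by rewrite scalerDr !scalerA mulrC.
by rewrite linearP scalerDl /= -[k *: (_ : K^o)]/(k * ε y) scalerA.
Qed.

(** Apply f to x = x_(1) ε(x_(2)). *)
Lemma counit_rho f x : ε (rho f x) = f x.
Proof.
have [s sE] := tens_sum (Δ x); rewrite [in RHS](counitr_sum sE) /rho sE slice_tsum.
rewrite !linear_sum; apply: eq_bigr => u _.
by rewrite !linearZ /= -[LHS]/((f u.1 : K) * ε u.2) mulrC.
Qed.

Lemma rho1 f : rho f 1 = (f 1 : K) *: 1.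
Proof. by rewrite /rho comul1 slice_tens. Qed.

(** Coassociativity: both sides are f(x_(1)) g(x_(2)) x_(3). *)
Lemma rho_rho f g x : rho g (rho f x) = rho (g \o rho f) x.
Proof.
have [s sE] := tens_sum (Δ x).
have hbil : bilin (fun a (t : tensor A A) => (f a : K) *: slice g t).
  exact: (bilin_pre idfun (slice g) (bilin_scale A f)).
have bilL : bilin (fun a1 a2 : A => a1 ⊗ Δ a2).
  exact: (bilin_pre idfun Δ (tens_bilin _ _)).
have bil3 a3 : bilin (fun a1 a2 : A => a1 ⊗ (a2 ⊗ a3)).
  exact: (bilin_pre idfun (lin ((tens_bilin A A).1 a3)) (tens_bilin _ _)).
have bilR : bilin (fun a1 a3 => \tsum_(a1', a2 <- Δ a1) a1' ⊗ (a2 ⊗ a3)).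
  split=> [y k a b|a k y z] /=; first by rewrite linearP tlift_linear.
  have [r ->] := tens_sum (Δ a); rewrite !tlift_tsum // scaler_sumr -big_split.
  apply: eq_bigr => u _ /=; rewrite ((tens_bilin A A).2 u.2 k).
  exact: (tens_bilin A (tensor A A)).2.
have /(congr1 (tlift (fun a (t : tensor A A) => (f a : K) *: slice g t))) :=
  comulA H x.
rewrite sE !tlift_tsum // !tlift_sum //.
under eq_bigr do rewrite tlift_tens //.
have -> : \sum_(u <- s) (f u.1 : K) *: slice g (Δ u.2) = rho g (rho f x).
  rewrite [rho f x]/rho sE slice_tsum linear_sum; apply: eq_bigr => u _.
  by rewrite linearZ.
move=> ->; rewrite [RHS]/rho sE slice_tsum; apply: eq_bigr => u _ /=.
rewrite /rho; have [r ->] := tens_sum (Δ u.1).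
rewrite tlift_tsum // tlift_sum // slice_tsum linear_sum scaler_suml.
apply: eq_bigr => v _; rewrite tlift_tens // slice_tens scalerA.
by congr (_ *: _); rewrite [RHS]funcZ.
Qed.

Lemma comulM_sum a b (s t : seq (A * A)) :
  Δ a = \sum_(u <- s) u.1 ⊗ u.2 -> Δ b = \sum_(v <- t) v.1 ⊗ v.2 ->
  Δ (a * b) = \sum_(u <- s) \sum_(v <- t) (u.1 * v.1) ⊗ (u.2 * v.2).
Proof.
move=> aE bE; rewrite comulM aE bE.
have mbil (u1 u2 : A) : bilin (fun b1 b2 : A => (u1 * b1) ⊗ (u2 * b2)).
  split=> [y k z z'|z k y y']; rewrite mulrDr -scalerAr.
    exact: (tens_bilin A A).1.
  exact: (tens_bilin A A).2.
rewrite tlift_tsum; first by apply: eq_bigr => u _; rewrite tlift_tsum.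
split=> [y k z z'|z k y y'] /=; rewrite !tlift_tsum // scaler_sumr -big_split;
  apply: eq_bigr => v _; rewrite mulrDl -scalerAl.
  exact: (tens_bilin A A).1.
exact: (tens_bilin A A).2.
Qed.

(** In Sweedler notation the sum is a_(2) rho (f(a_(1) _)) y. *)
Lemma rhoMl f a y (s : seq (A * A)) : Δ a = \sum_(u <- s) u.1 ⊗ u.2 ->
  rho f (a * y) = \sum_(u <- s) u.2 * rho (ltr f u.1) y.
Proof.
move=> aE; have [t tE] := tens_sum (Δ y).
rewrite /rho (comulM_sum aE tE) linear_sum; apply: eq_bigr => u _.
rewrite tE slice_tsum linear_sum mulr_sumr; apply: eq_bigr => v _ /=.
by rewrite slice_tens scalerAr.
Qed.

(** In Sweedler notation the sum is rho (f(_ c_(1))) x c_(2). *)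
Lemma rhoMr f x c (s : seq (A * A)) : Δ c = \sum_(v <- s) v.1 ⊗ v.2 ->
  rho f (x * c) = \sum_(v <- s) rho (rtr f v.1) x * v.2.
Proof.
move=> cE; have [t tE] := tens_sum (Δ x).
rewrite /rho (comulM_sum tE cE) exchange_big linear_sum; apply: eq_bigr => v _.
rewrite tE slice_tsum linear_sum mulr_suml; apply: eq_bigr => u _ /=.
by rewrite slice_tens scalerAl.
Qed.

Lemma aplus_linear : linear (aplus H).
Proof.
move=> k x y; rewrite /aplus linearP scalerDl opprD addrACA scalerBr scalerA.
by [].
Qed.

HB.instance Definition _ := GRing.isLinear.Build K A A *:%R (aplus H) aplus_linear.

Lemma aplus_rho f x : aplus H (rho f x) = rho f x - (f x : K) *: 1.
Proof. by rewrite /aplus counit_rho. Qed.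

End HopfSlices.

(** * Left coideal subalgebras and B-invariant functionals *)

Section Coideal.
Variables (K : fieldType) (A : algType K) (H : hopf A).
Variables (P : {pred A}) (B : subAlgType P).
Implicit Types (f g : {linear A -> K^o}) (a x y : A) (b c : B) (R : set A).

Local Notation Δ := (comul H).
Local Notation ε a := (counit H a : K).
Local Notation ι := (val : {linear B -> A}).
(* The functionals that factor through Abar, by [bar_inv] and [inv_bar]. *)
Local Notation inv g :=
  (forall (b : B) y, (g (val b * y) : K) = ε (val b) * (g y : K)).

Lemma counit_inv : inv (counit H : {linear A -> K^o}).
Proof. by move=> b y; rewrite rmorphM. Qed.

Lemma inv_val g b : inv g -> (g (val b) : K) = ε (val b) * (g 1 : K).
Proof. by move=> /(_ b 1) gi; rewrite -gi mulr1. Qed.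

(** The left side is rho g b - ε(b) g(1) 1, and invariance gives
    g(b) = ε(b) g(1). *)
Lemma rho_aplus g b : inv g ->
  rho H g (aplus H (val b)) = aplus H (rho H g (val b)).
Proof.
move=> gi; rewrite aplus_rho {1}/aplus linearB linearZ /= rho1.
by rewrite scalerA -inv_val.
Qed.

Hypothesis hB : left_coideal H B.

Lemma coactE b : tmap idfun ι (coact H b) = Δ (val b).
Proof.
suff [t tE] : exists t : tensor A B, tmap idfun ι t = Δ (val b).
  by apply: (xgetPex 0 (P := [set t | tmap idfun ι t = Δ (val b)])); exists t.
have tl := tlift_linear (tmap_bilin (idfun : {linear A -> A}) ι).
move: (Δ (val b)) (hB b); apply: span_min => [|_ [x [_ [c _ <-] ->]]]; last first.
  by exists (x ⊗ c); apply: (tlift_tens _ _ (tmap_bilin idfun ι)).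
split=> [|k x y [s sE] [t tE]].
  by exists 0; rewrite -[LHS]/(lin tl 0) linear0.
by exists (k *: s + t); rewrite /tmap tl -!/(tmap _ _ _) sE tE.
Qed.

Lemma coact_sum b : exists2 s : seq (A * B), coact H b = \sum_(u <- s) u.1 ⊗ u.2
  & Δ (val b) = \sum_(u <- [seq (u.1, val u.2) | u <- s]) u.1 ⊗ u.2.
Proof.
have [s sE] := tens_sum (coact H b); exists s => //.
by rewrite -coactE sE (tmap_tsum idfun ι) big_map.
Qed.

(** As val is injective, this and [slice_inj] reduce identities in A ⊗ B to
    identities about Δ. *)
Lemma val_slice_coact f b : val (slice f (coact H b)) = rho H f (val b).
Proof. by rewrite /rho -coactE (slice_tmap _ _ (f' := f)). Qed.

Lemma coact_linear : linear (coact H (B := B)).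
Proof.
move=> k b c; apply: slice_inj => f; apply: val_inj.
by rewrite val_slice_coact !linearP /= !val_slice_coact.
Qed.

(** g(f(b_(1) y_(1)) b_(2) y_(2)) = f(b_(1) y_(1)) ε(b_(2)) g(y_(2)), since
    b_(2) is in B; the counit then turns b_(1) ε(b_(2)) into b. *)
Lemma inv_rho_ltr f g b y : inv g ->
  g (rho H f (val b * y)) = g (rho H (ltr f (val b)) y).
Proof.
move=> gi; have [s _ sE] := coact_sum b.
rewrite (rhoMl _ _ sE) big_map linear_sum.
have /(slice_comb (Δ y)) : forall x,
    ltr f (val b) x = \sum_(u <- s) ε (val u.2) * ltr f u.1 x :> K.
  move=> x; rewrite /= {1}(counitr_sum sE) big_map mulr_suml linear_sum.
  by apply: eq_bigr => u _; rewrite -scalerAl funcZ.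
rewrite -/(rho _ _ _) => ->; rewrite linear_sum; apply: eq_bigr => u _.
by rewrite [RHS]funcZ gi.
Qed.

(** Invariant functionals are closed under convolution; in other words, the
    coproduct of A descends to Abar. *)
Lemma inv_rho f g : inv f -> inv g -> inv (g \o rho H f).
Proof.
move=> fi gi b y; rewrite /= inv_rho_ltr //.
have /(slice_comb (Δ y)) : forall x,
    ltr f (val b) x = \sum_(u <- [:: tt]) ε (val b) * f x :> K.
  by move=> x; rewrite big_seq1 /= fi.
by rewrite -/(rho _ _ _) => ->; rewrite big_seq1 funcZ.
Qed.

Local Notation barL := (proj _ : {linear A -> Abar H B}).

Lemma bar_inv (phi : {linear Abar H B -> K^o}) : inv (phi \o barL).
Proof.
move=> b y /=; rewrite -funcZ -linearZ_LR; congr (phi _); apply/pi_quotE/mem_gen.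
exists (aplus H (val b)); first by exists b.
by exists y; rewrite /aplus mulrBl -scalerAl mul1r.
Qed.

Lemma inv_bar g : inv g ->
  exists phi : {linear Abar H B -> K^o}, forall x, phi (bar H B x) = g x.
Proof.
move=> gi; apply: quot_lift => _ [_ [b ->] [a ->]].
by rewrite /aplus mulrBl -scalerAl mul1r linearB /= gi funcZ subrr.
Qed.

(** Functionals on Abar are the invariant functionals on A, so this is [tensrP]
    for Deltabar. *)
Lemma tensr_DeltabarP (N : set A) r : subspace N ->
  tensr (Abar H B) N (Deltabar H B r) <-> forall g, inv g -> N (rho H g r).
Proof.
move=> Ns; rewrite tensrP //.
have sE (phi : {linear Abar H B -> K^o}) g : (forall x, phi (bar H B x) = g x) ->
    slice phi (Deltabar H B r) = rho H g r.
  exact: (@slice_tmap K A (Abar H B) A A barL idfun phi g).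
split=> [NS g /inv_bar[phi /sE <-]|NS phi]; first exact: NS.
rewrite (sE phi (phi \o barL)) //; apply: NS; exact: bar_inv.
Qed.

Section RightIdeal.
Variable R : set A.
Hypothesis Rid : right_ideal H B R.

(** B is spanned by B^+ and 1. *)
Lemma right_ideal_mulr r b : R r -> R (r * val b).
Proof.
case: Rid => Rs _ RM Rr.
have -> : r * val b = r * aplus H (val b) + ε (val b) *: r.
  by rewrite /aplus mulrBr -scalerAr mulr1 subrK.
apply: subspaceD => //; last exact: subspaceZ.
by apply: RM => //; exists b.
Qed.

Lemma RprimeP r : Rprime H B R r <-> forall g, inv g -> R (rho H g r).
Proof. by case: Rid => Rs _ _; exact: tensr_DeltabarP. Qed.

Lemma Rprime_sub : Rprime H B R `<=` R.
Proof.
by move=> r /RprimeP/(_ _ counit_inv); rewrite rho_counit.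
Qed.

Lemma inv_rtr g a : inv g -> inv (rtr g a).
Proof. by move=> gi b y /=; rewrite -mulrA gi. Qed.

(** For c in B^+, rho g (r c) is the sum of the rho (g(_ c_(1))) r c_(2); the
    functional g(_ c_(1)) is again invariant and c_(2) is in B. *)
Lemma Rprime_right_ideal : right_ideal H B (Rprime H B R).
Proof.
have [Rs RB _] := Rid; split.
- split=> [|k x y /RprimeP Rx /RprimeP Ry]; apply/RprimeP => g gi.
    by rewrite linear0; case: Rs.
  by rewrite linearP; case: Rs => _; apply; [exact: Rx|exact: Ry].
- by move=> r /Rprime_sub/RB.
- move=> r _ /RprimeP Rr [b ->]; apply/RprimeP => g gi.
  have -> : aplus H (val b) = val (b - ε (val b) *: 1).
    by rewrite linearB linearZ /= rmorph1.
  have [s _ sE] := coact_sum (b - ε (val b) *: 1).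
  rewrite (rhoMr _ _ sE) big_map; apply: subspace_sum => // u _.
  by apply: right_ideal_mulr; apply: Rr; exact: inv_rtr.
Qed.

Lemma Rprime_stable r : Rprime H B R r ->
  tensr (Abar H B) (Rprime H B R) (Deltabar H B r).
Proof.
move=> /RprimeP Rr; have [R's _ _] := Rprime_right_ideal.
apply/tensr_DeltabarP => // f fi; apply/RprimeP => g gi.
by rewrite rho_rho; apply: Rr; exact: inv_rho.
Qed.

End RightIdeal.

(** In Sweedler notation this is f(a b_(1)) b_(2)^+. *)
Definition relform f (a b : B) : A := aplus H (rho H (ltr f (val a)) (val b)).

Lemma rho_ltrP f k a a' x :
  rho H (ltr f (k *: a + a')) x = k *: rho H (ltr f a) x + rho H (ltr f a') x.
Proof.
have [s sE] := tens_sum (Δ x).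
rewrite /rho sE !slice_tsum scaler_sumr -big_split; apply: eq_bigr => u _ /=.
by rewrite mulrDl linearD scalerDl -scalerAl funcZ scalerA.
Qed.

Lemma relform_bilin f : bilin (relform f).
Proof.
split=> [b k a a'|a k b b']; rewrite /relform; last by rewrite !linearP.
by rewrite linearP rho_ltrP !linearP.
Qed.

Lemma inv_rho_ltrE g b y : inv g ->
  rho H (ltr g (val b)) y = ε (val b) *: rho H g y.
Proof.
move=> gi; have /(slice_comb (Δ y)) : forall x,
    ltr g (val b) x = \sum_(u <- [:: tt]) ε (val b) * g x :> K.
  by move=> x; rewrite big_seq1 /= gi.
by rewrite -/(rho _ _ _) => ->; rewrite big_seq1.
Qed.

Lemma relform_inv g (a b : B) : inv g ->
  relform g a b = ε (val a) *: rho H g (aplus H (val b)).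
Proof.
by move=> gi; rewrite /relform inv_rho_ltrE // linearZ_LR rho_aplus.
Qed.

Lemma relform_counit (a b : B) :
  relform (counit H : {linear A -> K^o}) a b = ε (val a) *: aplus H (val b).
Proof. by rewrite relform_inv ?rho_counit //; exact: counit_inv. Qed.

End Coideal.

(** * Equivariance in terms of relations *)

Section DoubleLift.
Variables (K : fieldType) (V W V' W' U : lmodType K).
Variable F : V -> W -> V' -> W' -> U.
Hypothesis Fr : forall x y, bilin (F x y).
Hypothesis Fl : forall x' y', bilin (fun x y => F x y x' y').

Definition tlift2 (s : tensor V W) (t : tensor V' W') : U :=
  \tsum_(x, y <- s) \tsum_(x', y' <- t) F x y x' y'.

Lemma tlift2_inner t : bilin (fun x y => tlift (F x y) t).
Proof.
have [r ->] := tens_sum t; split=> [y k x x'|x k y y'] /=;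
  rewrite !tlift_tsum // scaler_sumr -big_split; apply: eq_bigr => u _.
  exact: (Fl u.1 u.2).1.
exact: (Fl u.1 u.2).2.
Qed.

Lemma tlift2_tsum (s : seq (V * W)) (t : seq (V' * W')) :
  tlift2 (\sum_(u <- s) u.1 ⊗ u.2) (\sum_(v <- t) v.1 ⊗ v.2) =
  \sum_(u <- s) \sum_(v <- t) F u.1 u.2 v.1 v.2.
Proof.
rewrite /tlift2 (tlift_tsum _ (tlift2_inner _)); apply: eq_bigr => u _.
exact: tlift_tsum.
Qed.

Lemma tlift2_bilin : bilin tlift2.
Proof.
split=> [t k s s'|s k t t']; rewrite /tlift2.
  by rewrite (tlift_linear (tlift2_inner t)).
have [r ->] := tens_sum s; rewrite !(tlift_tsum _ (tlift2_inner _)).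
rewrite scaler_sumr -big_split; apply: eq_bigr => u _.
exact: (tlift_linear (Fr u.1 u.2)).
Qed.

End DoubleLift.

Section Coform.
Variables (K : fieldType) (A : algType K) (H : hopf A).
Variables (P : {pred A}) (B : subAlgType P).
Hypothesis hB : left_coideal H B.
Implicit Types (f g : {linear A -> K^o}) (s t : seq (B * B)).

Local Notation Δ := (comul H).

Section Forms.
Variables (U : lmodType K) (D : B -> B -> U).
Hypothesis Dbil : bilin D.

(** Slicing the equivariance formula by f: this is
    f(a_(1) b_(1)) D(a_(2), b_(2)), and [tensform] is the formula itself. *)
Definition coform f (a b : B) : U :=
  tlift2 (fun (a1 : A) (a2 : B) (b1 : A) (b2 : B) => (f (a1 * b1) : K) *: D a2 b2)
    (coact H a) (coact H b).

Definition tensform (a b : B) : tensor A U :=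
  tlift2 (fun (a1 : A) (a2 : B) (b1 : A) (b2 : B) => (a1 * b1) ⊗ D a2 b2)
    (coact H a) (coact H b).

Let coformr f (a1 : A) a2 : bilin (fun (b1 : A) (b2 : B) => (f (a1 * b1) : K) *: D a2 b2).
Proof. exact: (bilin_pre idfun (lin (Dbil.2 a2)) (bilin_scale U (ltr f a1))). Qed.

Let coforml f (b1 : A) b2 : bilin (fun (a1 : A) (a2 : B) => (f (a1 * b1) : K) *: D a2 b2).
Proof. exact: (bilin_pre idfun (lin (Dbil.1 b2)) (bilin_scale U (rtr f b1))). Qed.

Let tensformr (a1 : A) a2 : bilin (fun (b1 : A) (b2 : B) => (a1 * b1) ⊗ D a2 b2).
Proof.
exact: (bilin_pre (lin ((mul_bilin A).2 a1)) (lin (Dbil.2 a2)) (tens_bilin A U)).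
Qed.

Let tensforml (b1 : A) b2 : bilin (fun (a1 : A) (a2 : B) => (a1 * b1) ⊗ D a2 b2).
Proof.
exact: (bilin_pre (lin ((mul_bilin A).1 b1)) (lin (Dbil.1 b2)) (tens_bilin A U)).
Qed.

Lemma coform_tsum f (a b : B) (p q : seq (A * B)) :
  coact H a = \sum_(u <- p) u.1 ⊗ u.2 -> coact H b = \sum_(v <- q) v.1 ⊗ v.2 ->
  coform f a b = \sum_(u <- p) \sum_(v <- q) (f (u.1 * v.1) : K) *: D u.2 v.2.
Proof. by move=> pE qE; rewrite /coform pE qE tlift2_tsum. Qed.

Lemma tensform_bilin : bilin tensform.
Proof.
exact: (bilin_pre (lin (coact_linear hB)) (lin (coact_linear hB))
  (tlift2_bilin tensformr tensforml)).
Qed.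

Lemma slice_tensform f (a b : B) : slice f (tensform a b) = coform f a b.
Proof.
have [p pE _] := coact_sum hB a; have [q qE _] := coact_sum hB b.
rewrite (coform_tsum _ pE qE) /tensform pE qE tlift2_tsum // linear_sum.
apply: eq_bigr => u _; rewrite linear_sum; apply: eq_bigr => v _.
exact: slice_tens.
Qed.

Lemma tensform_rel s :
  bsum tensform s = 0 <-> forall f, bsum (coform f) s = 0.
Proof.
have sE f : slice f (bsum tensform s) = bsum (coform f) s.
  by rewrite /bsum linear_sum; apply: eq_bigr => u _; exact: slice_tensform.
by split=> [Ds f|Ds]; [rewrite -sE Ds linear0|apply: slice0P => f; rewrite sE].
Qed.

End Forms.

(** The list t represents Σ f(a_(1) b_(1)) a_(2) ⊗ b_(2), the sum being over the
    pairs (a, b) in s. It is characterised by the value on it of all bilinear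
    maps D, since t will be used with several of them at once. *)
Definition coseq_spec f s t := forall (U : lmodType K) (D : B -> B -> U),
  bilin D -> bsum D t = bsum (coform D f) s.

Lemma coseq_exists f s : exists t, coseq_spec f s t.
Proof.
elim: s => [|[a b] s [t tP]].
  by exists [::] => U D Dbil; rewrite /bsum !big_nil.
have [p pE _] := coact_sum hB a; have [q qE _] := coact_sum hB b.
exists ([seq ((f (u.1 * v.1) : K) *: u.2, v.2) | u <- p, v <- q] ++ t) => U D Dbil.
rewrite bsum_cat tP //; rewrite [in RHS]/bsum big_cons; congr (_ + _).
rewrite (coform_tsum Dbil _ pE qE) /bsum big_allpairs_dep /=.
apply: eq_bigr => u _; apply: eq_bigr => v _.
by rewrite (bilinZl _ _ _ Dbil).
Qed.

(** Both sides are f(a_(1) b_(1)) g(a_(2) b_(2)) b_(3)^+. *)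
Lemma coform_relform f g (a b : B) :
  coform (relform H g) f a b = relform H (g \o rho H f) a b.
Proof.
have [p pE paE] := coact_sum hB a; have [q qE qbE] := coact_sum hB b.
rewrite (coform_tsum (relform_bilin H B g) _ pE qE) /relform.
have /(slice_comb (Δ (val b))) : forall y, ltr (g \o rho H f) (val a) y =
    \sum_(u <- p) 1 * (ltr g (val u.2) \o rho H (ltr f u.1)) y :> K.
  move=> y; rewrite /= (rhoMl _ _ paE) big_map linear_sum.
  by apply: eq_bigr => u _; rewrite mul1r.
rewrite -/(rho _ _ _) => ->; rewrite linear_sum; apply: eq_bigr => u _.
rewrite scale1r -/(rho _ _ _) -rho_rho [rho H (ltr f _) _]/rho qbE slice_tsum.
rewrite big_map !linear_sum; apply: eq_bigr => v _.
by rewrite !linearZ_LR.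
Qed.

Lemma relform_ext f g (a b : B) : f =1 g -> relform H f a b = relform H g a b.
Proof.
move=> fg; rewrite /relform /rho; have [r ->] := tens_sum (Δ (val b)).
by rewrite !slice_tsum; congr aplus; apply: eq_bigr => u _; rewrite /= fg.
Qed.

Lemma relform_coseq f g s t : coseq_spec f s t ->
  bsum (relform H g) t = bsum (relform H (g \o rho H f)) s.
Proof.
move=> /(_ _ _ (relform_bilin H B g))->; apply: eq_bigr => u _.
exact: coform_relform.
Qed.

Lemma relform_coseq1 f s t : coseq_spec f s t ->
  bsum (relform H (counit H : {linear A -> K^o})) t = bsum (relform H f) s.
Proof.
move=> /relform_coseq->; apply: eq_bigr => u _.
by apply: relform_ext => x /=; exact: (counit_rho H f x).
Qed.

(** By [gen_liftP] equivariance says that the relations of d kill [tensform],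
    and this is tested on slices. *)
Lemma equivariantP (d : derivation B) : equivariant H d <->
  forall f s, bsum (adb d) s = 0 -> bsum (coform (adb d) f) s = 0.
Proof.
have adbG_gen : @adbG _ _ d = gen (adb d).
  by apply/funext => a; apply/funext => b; exact: adbGE.
have dbil := adb_bilin d; have gbil := gen_bilin dbil.
have [lr rl] := gen_liftP dbil (tensform_bilin gbil).
have sE f s : bsum (coform (gen (adb d)) f) s = 0 <->
    bsum (coform (adb d) f) s = 0.
  by have [t tP] := coseq_exists f s; rewrite -(tP _ _ gbil) -(tP _ _ dbil) bsum_gen0.
split=> [[phi phiE] f s Ds|dE].
  apply/sE; move: f; apply/(tensform_rel gbil); apply: lr Ds.
  by exists phi => a b; rewrite -adbGE phiE -adbG_gen.
have [|phi phiE] := rl.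
  by move=> s Ds; apply/(tensform_rel gbil) => f; apply/sE; exact: dE.
by exists phi => a b; rewrite adbGE phiE -adbG_gen.
Qed.

End Coform.

(** * Derivations from right ideals and right ideals from derivations *)

Section Calculus.
Variables (K : fieldType) (A : algType K) (H : hopf A).
Variables (P : {pred A}) (B : subAlgType P).
Hypothesis hB : left_coideal H B.
Implicit Types (f g : {linear A -> K^o}) (s t : seq (B * B)) (d : derivation B).

Local Notation Δ := (comul H).
Local Notation ε a := (counit H a : K).
Local Notation εL := (counit H : {linear A -> K^o}).
Local Notation inv g :=
  (forall (b : B) y, (g (val b * y) : K) = ε (val b) * (g y : K)).
Local Notation relsum f s := (bsum (relform H f) s).

(** If Σ a_i d b_i = 0 then also (Σ a_i d b_i) c = 0, and this list of pairs is
    the resulting relation Σ (a_i d(b_i c) - a_i b_i d c) = 0. *)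
Definition leibseq s (c : B) : seq (B * B) :=
  [seq (u.1, u.2 * c) | u <- s] ++ [seq (- (u.1 * u.2), c) | u <- s].

Lemma bsum_leibseq (U : lmodType K) (D : B -> B -> U) s c : bilin D ->
  bsum D (leibseq s c) = bsum (fun a b => D a (b * c) - D (a * b) c) s.
Proof.
move=> Dbil; rewrite bsum_cat /bsum !big_map -big_split; apply: eq_bigr => u _.
by rewrite /= -[- (u.1 * u.2)]scaleN1r (bilinZl _ _ _ Dbil) scaleN1r.
Qed.

(** The scalar parts f(a b c) 1 of the two terms on the left cancel. *)
Lemma relform_leibniz f (a b c : B) (q : seq (A * A)) :
  Δ (val c) = \sum_(v <- q) v.1 ⊗ v.2 ->
  relform H f a (b * c) - relform H f (a * b) c =
  \sum_(v <- q) relform H (rtr f v.1) a b * v.2.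
Proof.
move=> qE; rewrite /relform !aplus_rho !rmorphM /= (rhoMr _ _ qE) !mulrA.
rewrite opprB addrA subrK {2}/rho qE slice_tsum -sumrB; apply: eq_bigr => v _.
rewrite aplus_rho mulrBl -scalerAl mul1r /=; congr (_ * _ - _).
rewrite /rho; have [r ->] := tens_sum (Δ (val b)).
by rewrite !slice_tsum; apply: eq_bigr => u _; rewrite /= mulrA.
Qed.

Section OfRightIdeal.
Variable R : set A.
Hypothesis Rid : right_ideal H B R.

Let Rs : subspace R. Proof. by case: Rid. Qed.

Lemma pR_eq0 (x : BplusT H B) : pR R x = 0 <-> R (span_val x).
Proof.
have Ns : subspace [set x : BplusT H B | R (span_val x)].
  by case: Rs => R0 RL; split=> [|k y z] //=; exact: RL.
rewrite -[0](linear0 (proj _)); split=> [/pi_quotE|Rx].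
  by rewrite subr0 in_spanE // => /asboolP.
by apply/pi_quotE; rewrite subr0 in_spanE //; exact/asboolP.
Qed.

Lemma bplus_linear : linear (bplus H (B := B)).
Proof. by move=> k b c; apply: val_inj; rewrite /= linearP linearP. Qed.

Lemma slice_dR f (a b : B) : slice f (dR_formula H R a b) =
  pR R (bplus H (slice (ltr f (val a)) (coact H b))).
Proof.
pose m := lin ((mul_bilin A).2 (val a)).
pose q : {linear B -> BplusQ H B R} := proj _ \o lin bplus_linear.
exact: (@slice_tmap _ _ _ _ _ m q f (ltr f (val a)) (coact H b) (fun=> erefl)).
Qed.

Lemma span_val_bplus f (a b : B) :
  span_val (bplus H (slice (ltr f (val a)) (coact H b))) = relform H f a b.
Proof. by rewrite /= val_slice_coact. Qed.

Lemma dR_formula_bilin : bilin (dR_formula H R (B := B)).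
Proof.
have key f : bilin (fun a b : B =>
    bplus H (slice (ltr f (val a)) (coact H b)) : BplusT H B).
  have [fl fr] := relform_bilin H B f.
  split=> [b k a a'|a k b b']; apply: val_inj;
    rewrite /= -/(relform _ _ _ _) !val_slice_coact // -!/(relform _ _ _ _).
    exact: fl.
  exact: fr.
split=> [b k a a'|a k b b']; apply: slice_inj => f;
  rewrite linearP /= !slice_dR /pR -linearP; congr (proj _ _).
  exact: (key f).1.
exact: (key f).2.
Qed.

(** Slicing the formula for d_R by f gives the class of relform f a b modulo R. *)
Lemma dR_formula_rel s :
  bsum (dR_formula H R) s = 0 <-> forall f, R (relsum f s).
Proof.
have sE f : slice f (bsum (dR_formula H R) s) = 0 <-> R (relsum f s).
  pose x := \sum_(u <- s) bplus H (slice (ltr f (val u.1)) (coact H u.2)).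
  have -> : slice f (bsum (dR_formula H R) s) = pR R x.
    rewrite /bsum linear_sum /pR linear_sum; apply: eq_bigr => u _.
    by rewrite [LHS]slice_dR.
  rewrite pR_eq0 /x span_val_sum.
  by under eq_bigr do rewrite span_val_bplus.
split=> [s0 f|Rf]; first by apply/sE; rewrite s0 linear0.
by apply: slice0P => f; apply/sE.
Qed.

Lemma is_dRP (d : derivation_on B (GammaR H B R)) :
  is_dR d <-> forall a b, adb d a b = gen (dR_formula H R) a b.
Proof.
by split=> dE a b; [apply: val_inj; exact: dE|rewrite dE].
Qed.

(** By [dR_formula_rel] the closure of the relations becomes: c a replaces
    f by f(c _), and by [relform_leibniz] right multiplication by c replaces f
    by the functionals f(_ c_(1)) and multiplies the result by c_(2) in B,
    under which R is stable. *)
Lemma dR_exists : exists d : derivation_on B (GammaR H B R), is_dR d.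
Proof.
have Dbil := dR_formula_bilin.
have [|c s|c s|d dE] := der_form_exists Dbil; last by exists d; apply/is_dRP.
- move=> a; have := dR_formula_rel [:: (a, 1)]; rewrite /bsum big_seq1 /= => -[_].
  apply=> f; rewrite big_seq1 /relform /= aplus_rho rmorph1 rho1 subrr.
  by case: Rs.
- have cE (U : lmodType K) (D : B -> B -> U) :
    bsum D [seq (c * u.1, u.2) | u <- s] = bsum (fun a b => D (c * a) b) s.
    by rewrite /bsum big_map.
  rewrite -(cE _ (dR_formula H R)) !dR_formula_rel => Rs' f.
  rewrite cE; suff -> : bsum (fun a b => relform H f (c * a) b) s =
    relsum (ltr f (val c)) s by exact: Rs'.
  apply: eq_bigr => u _; rewrite /relform /rho.
  have [r ->] := tens_sum (Δ (val u.2)).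
  rewrite !slice_tsum; congr aplus; apply: eq_bigr => v _.
  by rewrite /= rmorphM mulrA.
- rewrite -bsum_leibseq // !dR_formula_rel => Rs' f.
  have [q _ qE] := coact_sum hB c.
  rewrite (bsum_leibseq _ _ (relform_bilin H B f)) /bsum.
  under eq_bigr do rewrite (relform_leibniz _ _ _ qE) big_map.
  rewrite exchange_big /=; apply: subspace_sum => // v _.
  rewrite -mulr_suml; apply: (right_ideal_mulr Rid).
  exact: (Rs' (rtr f v.1)).
Qed.

Lemma dR_unique : exists! d : derivation_on B (GammaR H B R), is_dR d.
Proof.
have [d dP] := dR_exists; exists d; split=> // d' d'P.
by apply: (der_form_uniq dR_formula_bilin); apply/is_dRP.
Qed.

Lemma dR_rel s : bsum (adb (dR H B R)) s = 0 <-> forall f, R (relsum f s).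
Proof.
rewrite -dR_formula_rel /dR; case: pselect => [h|]; last by have := dR_exists.
have /is_dRP dE := projT2 (cid h).
rewrite -(bsum_gen0 (dR_formula H R)).
suff -> : bsum (adb (projT1 (cid h))) s = bsum (gen (dR_formula H R)) s by [].
by apply: eq_bigr => u _; exact: dE.
Qed.

(** The operation of [coseq_exists] replaces the family of all functionals g
    that test membership by the g \o rho f. *)
Lemma dR_equivariant : equivariant H (dR H B R).
Proof.
apply/(equivariantP hB) => f s /dR_rel Rs'.
have [t tP] := coseq_exists hB f s.
rewrite -(tP _ _ (adb_bilin _)); apply/dR_rel => g.
by rewrite (relform_coseq hB _ tP); exact: Rs'.
Qed.

End OfRightIdeal.

Lemma dR_mono R1 R2 s : right_ideal H B R1 -> right_ideal H B R2 -> R1 `<=` R2 ->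
  bsum (adb (dR H B R1)) s = 0 -> bsum (adb (dR H B R2)) s = 0.
Proof.
by move=> R1i R2i R12 /(dR_rel R1i) s1; apply/(dR_rel R2i) => f; apply: R12.
Qed.

(** For invariant g, rho g (relform f a b) = relform (g \o rho f) a b, so a sum
    tested by all f against R is already tested against R'. *)
Lemma dR_Rprime R : right_ideal H B R -> der_eq (dR H B R) (dR H B (Rprime H B R)).
Proof.
move=> Rid; have R'id := Rprime_right_ideal hB Rid.
split; apply/der_leP => s; last by apply: dR_mono => //; exact: Rprime_sub.
move=> /(dR_rel Rid) Rs; apply/(dR_rel R'id) => f; apply/RprimeP => // g gi.
suff -> : rho H g (relsum f s) = relsum (g \o rho H f) s by [].
rewrite /bsum linear_sum; apply: eq_bigr => u _ /=.
rewrite /relform -(val_slice_coact hB) rho_aplus // val_slice_coact // rho_rho.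
congr aplus; rewrite /rho; have [r ->] := tens_sum (Δ (val u.2)).
rewrite !slice_tsum; apply: eq_bigr => v _; congr (_ *: _).
by rewrite /= inv_rho_ltr.
Qed.

Lemma RdP d x : Rd H d x <-> exists2 s, bsum (adb d) s = 0 & x = relsum εL s.
Proof.
have sE s : \sum_(u <- s) ε (val u.1) *: aplus H (val u.2) = relsum εL s.
  by apply: eq_bigr => u _; rewrite relform_counit.
by split=> -[s s0 ->]; exists s.
Qed.

(** Stability under B^+ comes from multiplying a relation on the right, as in
    [leibseq]: ε(a) (b c)^+ - ε(a b) c^+ = ε(a) b^+ c. *)
Lemma Rd_right_ideal d : right_ideal H B (Rd H d).
Proof.
have dbil := adb_bilin d; have rbil := relform_bilin H B εL.
split.
- split; first by apply/RdP; exists [::]; rewrite /bsum big_nil.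
  move=> k _ _ /RdP[s s0 ->] /RdP[t t0 ->]; apply/RdP.
  exists ([seq (k *: u.1, u.2) | u <- s] ++ t).
    by rewrite bsum_cat bsumZ // s0 t0 scaler0 addr0.
  by rewrite bsum_cat bsumZ.
- move=> _ /RdP[s _ ->]; exists (\sum_(u <- s) ε (val u.1) *: u.2).
  rewrite !linear_sum; apply: eq_bigr => u _.
  by rewrite relform_counit !linearZ.
move=> _ _ /RdP[s s0 ->] [b ->].
set c := b - ε (val b) *: 1; have cE : aplus H (val b) = val c.
  by rewrite linearB linearZ /= rmorph1.
apply/RdP; exists (leibseq s c).
  rewrite bsum_leibseq //; suff -> :
    bsum (fun a b => adb d a (b * c) - adb d (a * b) c) s =
    ract d (bsum (adb d) s) c by rewrite s0 (bilin0l _ (ract_bilin d)).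
  rewrite /bsum (bilin_suml _ _ _ (ract_bilin d)); apply: eq_bigr => u _.
  rewrite /adb lractA derM lactM -[lact d _ (_ + _)]/(lin ((lact_bilin d).2 _) _).
  by rewrite linearD /= addrC addKr.
rewrite bsum_leibseq // cE mulr_suml; apply: eq_bigr => u _.
rewrite !relform_counit !rmorphM /= -[X in _ - X]scalerA -scalerBr -scalerAl.
congr (_ *: _); rewrite /aplus rmorphM mulrBl -scalerAl mul1r scalerBr scalerA.
by rewrite opprB addrA subrK.
Qed.

(** For invariant g, rho g carries [relform ε] to [relform g], and a relation
    summed by [relform g] is an equivariant translate of it summed by
    [relform ε]. *)
Lemma Rd_stable d r : equivariant H d -> Rd H d r ->
  tensr (Abar H B) (Rd H d) (Deltabar H B r).
Proof.
move=> /(equivariantP hB) dE /RdP[s s0 ->].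
have [Rs _ _] := Rd_right_ideal d; apply/tensr_DeltabarP => // g gi.
have [t tP] := coseq_exists hB g s; apply/RdP; exists t.
  by rewrite (tP _ _ (adb_bilin d)); exact: dE.
rewrite (relform_coseq1 hB tP) /bsum linear_sum; apply: eq_bigr => u _.
by rewrite relform_counit (relform_inv _ _ gi) linearZ.
Qed.

Lemma Rd_dR_sub R : right_ideal H B R -> Rd H (dR H B R) `<=` R.
Proof. by move=> Rid _ /RdP[s /(dR_rel Rid) Rs ->]. Qed.

(** Σ relform f a_i b_i is Σ relform ε over the translate of the relation
    by f, which is again a relation of d. *)
Lemma dR_Rd_le d : equivariant H d -> der_le (dR H B (Rd H d)) d.
Proof.
move=> /(equivariantP hB) dE; apply/der_leP => s s0.
apply/(dR_rel (Rd_right_ideal d)) => f.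
have [t tP] := coseq_exists hB f s; apply/RdP; exists t.
  by rewrite (tP _ _ (adb_bilin d)); exact: dE.
by rewrite (relform_coseq1 hB tP).
Qed.

Lemma Rd_anti d1 d2 : der_le d1 d2 -> Rd H d2 `<=` Rd H d1.
Proof.
by move=> /der_leP le12 _ /RdP[s s0 ->]; apply/RdP; exists s => //; exact: le12.
Qed.

Lemma dR_anti R1 R2 : right_ideal H B R1 -> right_ideal H B R2 -> R2 `<=` R1 ->
  der_le (dR H B R1) (dR H B R2).
Proof. by move=> R1i R2i R21; apply/der_leP => s; exact: dR_mono. Qed.

Lemma der_le_trans d1 d2 d3 : der_le d1 d2 -> der_le d2 d3 -> der_le d1 d3.
Proof.
by move=> /der_leP le12 /der_leP le23; apply/der_leP => s /le23/le12.
Qed.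

Lemma Rd_dR_Rd d : equivariant H d -> Rd H (dR H B (Rd H d)) = Rd H d.
Proof.
move=> dE; apply/seteqP; split; first by apply: Rd_dR_sub; exact: Rd_right_ideal.
by apply: Rd_anti; exact: dR_Rd_le.
Qed.

Lemma dR_Rd_dR R : right_ideal H B R ->
  der_eq (dR H B (Rd H (dR H B R))) (dR H B R).
Proof.
move=> Rid; split; last first.
  by apply: dR_Rd_le; exact: dR_equivariant.
by apply: dR_anti (Rd_dR_sub Rid) => //; exact: Rd_right_ideal.
Qed.

End Calculus.

Theorem theorem1 (RR : realType) (A : algType RR[i]) (H : hopf A)
    (P : {pred A}) (B : subAlgType P) (hB : left_coideal H B) :
  (* (i) *)
  (forall R : set A, right_ideal H B R ->
     [/\ exists! d : derivation_on B (GammaR H B R), is_dR d,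
         equivariant H (dR H B R) &
         [/\ right_ideal H B (Rprime H B R),
             Rprime H B R `<=` R,
             (forall r, Rprime H B R r ->
                tensr (Abar H B) (Rprime H B R) (Deltabar H B r)) &
             der_eq (dR H B R) (dR H B (Rprime H B R))]]) /\
  (* (ii) *)
  (forall d : derivation B,
     right_ideal H B (Rd H d) /\
     (equivariant H d -> forall r, Rd H d r ->
        tensr (Abar H B) (Rd H d) (Deltabar H B r))) /\
  (* (iii) *)
  (let ideals : set (set A) :=
     [set R | exists2 d : derivation B, equivariant H d & R = Rd H d] in
   let derivations : derivation B -> Prop :=
     fun d => exists2 R : set A, right_ideal H B R & der_eq d (dR H B R) in
   [/\ [/\ (forall R, ideals R -> derivations (dR H B R)),
           (forall d, derivations d -> ideals (Rd H d)),
           (forall R, ideals R -> Rd H (dR H B R) = R) &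
           (forall d, derivations d -> der_eq (dR H B (Rd H d)) d)],
       (forall R1 R2, ideals R1 -> ideals R2 ->
          (der_le (dR H B R1) (dR H B R2) <-> R2 `<=` R1)),
       (forall d1 d2, derivations d1 -> derivations d2 ->
          (der_le d1 d2 <-> Rd H d2 `<=` Rd H d1)),
       (forall R : set A, right_ideal H B R -> Rd H (dR H B R) `<=` R) &
       (forall d : derivation B, equivariant H d ->
          der_le (dR H B (Rd H d)) d)]).
Proof.
have id_eq d R : der_eq d (dR H B R) -> Rd H d = Rd H (dR H B R).
  by move=> [le1 le2]; apply/seteqP; split; exact: Rd_anti.
split=> [R Rid|].
  split; [exact: dR_unique|exact: dR_equivariant|split].
  - exact: Rprime_right_ideal.
  - exact: Rprime_sub.
  - exact: Rprime_stable.
  - exact: dR_Rprime.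
split=> [d|ideals derivations].
  by split=> [|dE r]; [exact: Rd_right_ideal|exact: Rd_stable].
have ideals_right R : ideals R -> right_ideal H B R.
  by move=> [d _ ->]; exact: Rd_right_ideal.
have closed_ideal R : ideals R -> Rd H (dR H B R) = R.
  by move=> [d dE ->]; exact: Rd_dR_Rd.
have closed_der d : derivations d -> der_eq (dR H B (Rd H d)) d.
  move=> [R Rid dR]; have [le1 le2] := dR_Rd_dR hB Rid; rewrite (id_eq _ _ dR).
  case: dR => le3 le4; split; first exact: (der_le_trans le4 le1).
  exact: (der_le_trans le2 le3).
split.
- split=> //.
  + by move=> R /ideals_right Rid; exists R => //; split; apply/der_leP.
  + by move=> d [R Rid /id_eq->]; exists (dR H B R) => //; exact: dR_equivariant.
- move=> R1 R2 R1i R2i; split=> [le12 x R2x|R21].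
    rewrite -(closed_ideal _ R1i); apply: (Rd_anti le12).
    by rewrite (closed_ideal _ R2i).
  by apply: dR_anti R21 => //; exact: ideals_right.
- move=> d1 d2 /closed_der[le1 le1'] /closed_der[le2 le2'].
  split=> [|R21]; first exact: Rd_anti.
  have le12 : der_le (dR H B (Rd H d1)) (dR H B (Rd H d2)).
    by apply: dR_anti R21 => //; exact: Rd_right_ideal.
  exact: (der_le_trans le1 (der_le_trans le12 le2')).
- by move=> R; exact: Rd_dR_sub.
- by move=> d; exact: dR_Rd_le.
Qed.
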